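(* Let $\delta>0$ and let $x$ and $y$ be two strings of length $n$ such that each character occurs at most $k$ times in $y$. Then there is an algorithm in the asymmetric streaming setting using $O(\delta^{-1}k\log^2 n)$ space that outputs an additive $\delta n$-approximation of $E(x,y)$ (with error probability $n^{-\Omega(1)}$).
   Context: For strings $x,y$ of length $n$, $LCS(x,y)$ is the length of a longest common subsequence and $E(x,y)=n-LCS(x,y)$. An additive $\delta n$-approximation is a value $v$ with $E(x,y)\le v\le E(x,y)+\delta n$. In the asymmetric streaming setting the algorithm has free random access to $y$ and one-pass streaming access to $x$ (symbols of $x$ arrive in order and cannot be revisited); space is counted in memory cells each holding a symbol, an index, or an integer polynomial in $n$. *)

(* Defs.v *)
From HB Require Import structures.
From mathcomp Require Import all_boot all_order all_algebra.
From mathcomp Require Import reals exp.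

Set Implicit Arguments.
Unset Strict Implicit.
Unset Printing Implicit Defensive.

Import Order.TTheory GRing.Theory Num.Theory.
Local Open Scope ring_scope.

(* The subsequences of x are exactly the mask m x, see subseqP. *)
Definition LCS (S : eqType) (x y : seq S) : nat :=
  \max_(m : (size x).-tuple bool | subseq (mask m x) y) size (mask m x).

Definition E (S : eqType) (n : nat) (x y : n.-tuple S) : nat := (n - LCS x y)%N.

Definition additive_approx (R : realType) (S : eqType) (delta : R) (n : nat)
    (x y : n.-tuple S) (v : nat) : bool :=
  ((E x y)%:R <= v%:R :> R) && (v%:R <= (E x y)%:R + delta * n%:R :> R).

(* Asymmetric streaming algorithms are programs of a random-access machine.   *)
(* The syntax mentions neither the alphabet nor any parameter value, so one   *)
(* program serves all alphabets, lengths n, multiplicities k and reals delta. *)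
(* A memory cell holds an integer (or index), [inl], or a symbol, [inr];      *)
(* symbols can be copied and compared for equality, nothing else.             *)
Definition cell (S : eqType) := (nat + S)%type.

Definition int_of (S : eqType) (v : cell S) : nat := if v is inl m then m else 0.

Inductive expr :=
  | Lit of nat
  | ParN
  | ParK
  | Cell of expr
  | Y of expr
  | Add of expr & expr
  | Sub of expr & expr
  | Mul of expr & expr
  | Div of expr & expr.

Inductive test :=
  | Eq of expr & expr
  | Le of expr & expr
  | LeDelta of expr & expr
  | Not of test
  | And of test & test.

Inductive cmd :=
  | Skip
  | Assign of expr & expr
  | ReadX of expr
  | Draw of expr & expr
  | Seq of cmd & cmd
  | If of test & cmd & cmd
  | While of test & cmd.

(* Read-only data, not charged as space. The stream x is not part of it. *)
Record input (R : realType) (S : eqType) :=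
  Input { delta_in : R; len_in : nat; mult_in : nat; y_in : seq S }.

(* [memory] only grows, so [size (memory s)] is one plus the largest address  *)
(* written since the beginning of the run; likewise [peak s] is the largest   *)
(* integer written since the beginning. In a final state they bound the       *)
(* number of cells and their contents at every moment of the run.             *)
(* [stream] is the part of x not yet received.                                *)
Record state (S : eqType) :=
  State { memory : seq (cell S); peak : nat; stream : seq S }.

Definition init (S : eqType) (x : seq S) : state S := State [::] 0 x.

Definition write (S : eqType) (s : state S) (a : nat) (v : cell S) : state S :=
  State (set_nth (inl 0%N) (memory s) a v) (maxn (peak s) (int_of v)) (stream s).

(* Arithmetic is that of nat (Sub truncates, division by 0 is 0); reading an  *)
(* unwritten cell or y out of range gives the integer 0. Expressions occur    *)
(* inside a fixed program, so their evaluation needs O(1) further cells.      *)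
Fixpoint eval (R : realType) (S : eqType) (w : input R S) (s : state S)
    (e : expr) : cell S :=
  let int e := int_of (eval w s e) in
  match e with
  | Lit m => inl m
  | ParN => inl (len_in w)
  | ParK => inl (mult_in w)
  | Cell e1 => nth (inl 0%N) (memory s) (int e1)
  | Y e1 => nth (inl 0%N) (map inr (y_in w)) (int e1)
  | Add e1 e2 => inl (int e1 + int e2)%N
  | Sub e1 e2 => inl (int e1 - int e2)%N
  | Mul e1 e2 => inl (int e1 * int e2)%N
  | Div e1 e2 => inl (int e1 %/ int e2)%N
  end.

(* The real delta is accessible only through comparisons with fractions. *)
Fixpoint holds (R : realType) (S : eqType) (w : input R S) (s : state S)
    (b : test) : bool :=
  match b with
  | Eq e1 e2 => eval w s e1 == eval w s e2
  | Le e1 e2 => (int_of (eval w s e1) <= int_of (eval w s e2))%N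
  | LeDelta e1 e2 =>
      (int_of (eval w s e1))%:R <= delta_in w * (int_of (eval w s e2))%:R
  | Not b1 => ~~ holds w s b1
  | And b1 b2 => holds w s b1 && holds w s b2
  end.

(* Finite probability trees; [Choose m f] branches uniformly over f 0 .. f m. *)
Inductive rtree (A : Type) :=
  | Ret of A
  | Choose of nat & (nat -> rtree A).

Fixpoint bind (A B : Type) (t : rtree A) (g : A -> rtree B) : rtree B :=
  match t with
  | Ret a => g a
  | Choose m f => Choose m (fun i => bind (f i) g)
  end.

Fixpoint prob (R : realType) (A : Type) (p : pred A) (t : rtree A) : R :=
  match t with
  | Ret a => (p a)%:R
  | Choose m f => (\sum_(i < m.+1) prob R p (f i)) / m.+1%:R
  end.

Fixpoint always (A : Type) (P : A -> Prop) (t : rtree A) : Prop :=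
  match t with
  | Ret a => P a
  | Choose m f => forall i : 'I_m.+1, always P (f i)
  end.

(* [None] means that the fuel ran out. ReadX stores the next symbol of x (the *)
(* integer 0 once x is exhausted); [Draw a e] stores in cell a a uniformly    *)
(* random integer in [0, e), or 0 when e evaluates to 0. The result is left   *)
(* in cell 0, see [output].                                                   *)
Fixpoint exec (R : realType) (S : eqType) (w : input R S) (fuel : nat) (c : cmd)
    (s : state S) : rtree (option (state S)) :=
  if fuel is fuel'.+1 then
    let int e := int_of (eval w s e) in
    let run c s := exec w fuel' c s in
    let andthen t c := bind t (fun o => if o is Some s' then run c s' else Ret None) in
    match c with
    | Skip => Ret (Some s)
    | Assign a e => Ret (Some (write s (int a) (eval w s e)))
    | ReadX a =>
        Ret (Some (if stream s is u :: x'
                   then write (State (memory s) (peak s) x') (int a) (inr u)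
                   else write s (int a) (inl 0%N)))
    | Draw a e =>
        Choose (int e).-1 (fun i => Ret (Some (write s (int a) (inl i))))
    | Seq c1 c2 => andthen (run c1 s) c2
    | If b c1 c2 => run (if holds w s b then c1 else c2) s
    | While b c1 =>
        if holds w s b then andthen (run c1 s) (While b c1) else Ret (Some s)
    end
  else Ret None.

Definition output (S : eqType) (s : state S) : nat :=
  int_of (nth (inl 0%N) (memory s) 0).

Definition outcome_in (S : eqType) (good : pred nat) (o : option (state S)) : bool :=
  if o is Some s then good (output s) else false.

Definition halts_within (S : eqType) (space width : nat) (o : option (state S)) : Prop :=
  if o is Some s then (size (memory s) <= space)%N /\ (peak s <= width)%N else False.

(* Main.v *)
Require Import Defs.
From HB Require Import structures.
From mathcomp Require Import all_boot all_order all_algebra.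
From mathcomp Require Import reals exp.
From mathcomp Require Import zify ring lra.
From Stdlib Require Import FunctionalExtensionality.

(* Keep [8 m lev^2] slots, where [m] is about [1/delta] and [lev] about       *)
(* [log n]. A slot has a width [w], a power of 2, and a seed [sg] uniform in  *)
(* [0, w); it always stores the column of the last time [t] with              *)
(* [t = sg %[mod w]], that is, the symbol [x_t] together with an estimate of  *)
(* the longest common subsequence ending at [(t, i)] for each of the at most  *)
(* [k] positions [i] with [y_i = x_t]. A new column is computed from the      *)
(* stored ones only, so estimates never exceed the true values.               *)
(* Fix an optimal chain. Just before time [T] a slot of width [w] holds a     *)
(* uniformly random one of the last [w] times, so if more than a [1/m]        *)
(* fraction of the times of a window ending at [T] belong to the chain, a     *)
(* slot whose width is the window length rounded up to a power of 2 holds one *)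
(* of them with probability at least [1/(2m)]. There are [8 m lev] such       *)
(* slots, so with high probability every such window is hit. Walking back     *)
(* along the chain from one remembered point to the latest earlier one then   *)
(* skips at most a [1/m] fraction of the time elapsed, [n/m] points in total. *)

Set Implicit Arguments.
Unset Strict Implicit.
Unset Printing Implicit Defensive.

Import Order.TTheory GRing.Theory Num.Theory.

(** * Common subsequences and the estimate computed from remembered columns *)

(** The output is [n - estimate n n]. The estimate is the length of the longest chain of matches in
    which the column of each point is still in memory at the time of the next one (after the last
    point: at time [n]). Such a chain is a common subsequence whatever the seeds, so the output is
    never below [E x y] ([estimate_sound], [est_le_LCS]).

    For the other side, an optimal chain is fixed before any seed is drawn. [chain_loss] is
    deterministic: if every window where the chain has density above 1/m is hit, at most n/m points
    are lost. This is at most delta n when delta m >= 1, and it is 0 by integrality when m > n. What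
    a slot remembers depends on its width, its seed and the clock, never on the data, so the misses
    of one window by different slots are independent. A slot of the right width misses with
    probability at most 1 - 1/(2m) ([miss_prob]), all 8 m lev of them with probability at most 2^(-4
    lev) ([bad_prob]), and a union bound over n^2 windows leaves failure probability at most 1/n
    ([good_seeds_prob]).

    The machine is tied to this analysis by a total-correctness calculus [wp] for the deterministic
    phases and by an equality of probability trees for the drawing loop ([exec_draw_seeds]);
    [run_spec] joins them. The memory is 16 + (8 m lev^2 + 1)(k + 3) cells, where m <= 2/delta and
    lev = O(log n) ([space_bound]). This bound holds on every run; only the quality of the answer is
    random. *)

Section CommonSubsequences.
Variables (S : eqType) (x0 : S).
Implicit Types u x y : seq S.

Lemma subseq_leq_LCS u x y : subseq u x -> subseq u y -> size u <= LCS x y.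
Proof.
case/subseqP=> m sz_m -> sub_y; rewrite /LCS.
have sz : size m == size x by apply/eqP.
exact: (@leq_bigmax_cond _ (fun m : (size x).-tuple bool => subseq (mask m x) y)
  (fun m : (size x).-tuple bool => size (mask m x)) (Tuple sz)).
Qed.

Lemma LCS_witness x y :
  exists u, [/\ subseq u x, subseq u y & size u = LCS x y].
Proof.
rewrite /LCS; elim/big_ind: _ => [|a b [u [ux uy ua]] [v [vx vy vb]]|m sub_y].
- by exists [::]; rewrite !sub0seq.
- by case: (leqP a b) => _; [exists v | exists u].
- by exists (mask m x); split=> //; apply: mask_subseq.
Qed.

Lemma subseq_embedding u x : subseq u x -> exists f : nat -> nat,
  [/\ forall i, i < size u -> f i < size x /\ nth x0 x (f i) = nth x0 u i &
      forall i i', i < i' -> i' < size u -> f i < f i'].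
Proof.
elim: x u => [|b x IH] [|a u] //=; try by exists id.
case: eqP => [-> /IH [f [fP f_mono]]|_ /IH [f [fP f_mono]]].
  exists (fun i => if i is i'.+1 then (f i').+1 else 0); split.
    by case=> [|i] //= /fP [].
  by case=> [|i] [|i'] //= ii' i'u; apply: f_mono.
exists (fun i => (f i).+1); split=> [i /fP [] //|i i' ii' i'u] /=.
exact: f_mono.
Qed.

Lemma rcons_subseq_take u x t T :
  t < T -> T <= size x -> subseq u (take t x) ->
  subseq (rcons u (nth x0 x t)) (take T x).
Proof.
move=> tT Tx ux; have tx : t < size x by apply: leq_trans Tx.
apply: (@subseq_trans _ (take t.+1 x)).
  by rewrite (take_nth x0) // -!cats1 cat_subseq.
by rewrite -(take_takel x tT) take_subseq.
Qed.

End CommonSubsequences.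

Fixpoint held (w sg T : nat) : option nat :=
  if T is t.+1 then if t %% w == sg then Some t else held w sg t else None.

Lemma held_lt w sg T t : held w sg T = Some t -> t < T.
Proof.
elim: T => //= T IH; case: ifP => _ [] // => [->//|/IH].
by move=> tT; apply: ltnW.
Qed.

(** Distinct times with the same residue are at least [w] apart, so no later time of this residue
    fits below [T]. *)
Lemma held_window w sg T t :
  t %% w = sg -> t < T -> T <= t + w -> held w sg T = Some t.
Proof.
move=> tw; elim: T => //= T IH.
rewrite ltnS leq_eqVlt => /orP[/eqP <-|tT] TW; first by rewrite tw eqxx.
rewrite ifF; first by apply: IH => //; apply: ltnW.
apply/negbTE; rewrite -tw eqn_mod_dvd; last exact: ltnW.
apply/negP => /dvdn_leq; lia.
Qed.

Section Estimate.
Variables (S : eqType) (x0 : S) (x y : seq S).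
Variables (ns : nat) (W sg : nat -> nat).

(** The true recursion is on the time [T], which drops to an arbitrary earlier held time; [d] is
    fuel that makes it structural. Since held times are smaller than [T], any fuel [d >= T] gives
    the same value ([qrecE]), whence the unfolding equation [estimateE]. *)
Fixpoint qrec (d T j : nat) : nat :=
  if d is d'.+1 then
    \max_(z < ns)
      (if held (W z) (sg z) T is Some t then
         \max_(i < j | nth x0 y i == nth x0 x t) (qrec d' t i).+1 else 0)
  else 0.

Definition estimate T j := qrec T T j.

Definition slot_best (o : option nat) j :=
  if o is Some t then
    \max_(i < j | nth x0 y i == nth x0 x t) (estimate t i).+1 else 0.

Lemma qrecE d T j : T <= d -> qrec d T j = estimate T j.
Proof.
elim/ltn_ind: T d j => T IH [|d] j; first by rewrite leqn0 => /eqP->.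
move=> Td; rewrite /estimate; case: T => [|T] in Td IH *.
  by rewrite /= big1.
rewrite /=; apply: eq_bigr => z _; rewrite -/(held (W z) (sg z) T.+1).
case E : (held _ _ T.+1) => [t|//]; move/held_lt: E => tT.
by apply: eq_bigr => i _; rewrite IH // ?IH //; lia.
Qed.

Lemma estimateE T j :
  estimate T j = \max_(z < ns) slot_best (held (W z) (sg z) T) j.
Proof.
rewrite -(qrecE j (leqnSn T)) /=; apply: eq_bigr => z _.
case E : (held _ _ T) => [t|//] /=; move/held_lt: E => tT.
by apply: eq_bigr => i _; rewrite qrecE // ltnW.
Qed.

Lemma estimate_ge z t T i j :
  z < ns -> held (W z) (sg z) T = Some t -> i < j ->
  nth x0 y i = nth x0 x t -> estimate t i < estimate T j.
Proof.
move=> zn hz ij yx; rewrite (estimateE T).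
apply: leq_trans (leq_bigmax (Ordinal zn)) => /=; rewrite hz /=.
apply: (@leq_bigmax_cond _ (fun i : 'I_j => nth x0 y i == nth x0 x t)
  (fun i : 'I_j => (estimate t i).+1) (Ordinal ij)).
by rewrite /= yx.
Qed.

(** Each recursive step appends one matched symbol to a common subsequence of shorter prefixes. No
    assumption on slots or seeds enters, so the estimate never exceeds the LCS. *)
Lemma estimate_sound T j : T <= size x -> j <= size y ->
  exists u, [/\ subseq u (take T x), subseq u (take j y) & size u = estimate T j].
Proof.
elim/ltn_ind: T j => T IH j Tx jy; rewrite estimateE.
(* A maximum is attained by one of its terms or is the default 0, witnessed by the empty
   sequence. *)
have bmax (I : Type) (r : seq I) (P : pred I) F :
    (forall i, P i ->
       exists u, [/\ subseq u (take T x), subseq u (take j y) & size u = F i]) ->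
    exists u, [/\ subseq u (take T x), subseq u (take j y)
                & size u = \max_(i <- r | P i) F i].
  move=> FP; elim/big_ind: _ => [|a b [u uP] [v vP]|i /FP]; last by [].
    by exists [::]; rewrite !sub0seq.
  by case: (leqP a b) => _; [exists v | exists u].
apply: (bmax) => z _; rewrite /slot_best.
case E : (held _ _ T) => [t|]; last by exists [::]; rewrite !sub0seq.
have tT := held_lt E; apply: bmax => i /eqP yx.
have ij := ltn_ord i.
have [||u [ux uy <-]] := IH t tT i; rewrite ?size_rcons; try lia.
exists (rcons u (nth x0 x t)); split; last by rewrite size_rcons.
  exact: rcons_subseq_take ux.
by rewrite -yx; apply: rcons_subseq_take uy.
Qed.

Lemma estimate_le T j : T <= size x -> j <= size y -> estimate T j <= T.
Proof.
move=> Tx jy; have [u [ux _ <-]] := estimate_sound Tx jy.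
by apply: leq_trans (size_subseq ux) _; rewrite size_take; case: ltnP.
Qed.

Section Chain.
Variables (m h : nat) (f g : nat -> nat).

(** Chain points [b] to [e - 1] are charged to the times from [gap_start b] up to but excluding
    [f e]. Starting right after the previous point makes the skipped windows disjoint. *)
Definition gap_start b := if b is b'.+1 then (f b').+1 else 0.

(** The only property of the random seeds that the analysis of the loss uses; the inequality says
    that the density of the chain in the window exceeds 1/m. *)
Definition hits_dense_windows := forall b e, b < e -> e <= h ->
  f e - gap_start b < m * (e - b) ->
  exists z i, [/\ z < ns, b <= i < e & held (W z) (sg z) (f e) = Some (f i)].

Hypothesis f_mono : forall i i', i < i' -> i' <= h -> f i < f i'.
Hypothesis g_mono : forall i i', i < i' -> i' <= h -> g i < g i'.
Hypothesis fg : forall i, i < h -> nth x0 y (g i) = nth x0 x (f i).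

(* Going back from chain point [e] to the latest earlier chain point still in
   memory skips at most a [1/m] fraction of the time interval jumped over. *)
Lemma chain_loss : hits_dense_windows ->
  forall e, e <= h -> (e - estimate (f e) (g e)) * m <= f e.
Proof.
move=> good; elim/ltn_ind => e IH eh.
(* The same property without subtraction of times; for [b = e] the inequality contradicts
   monotonicity. *)
have go b : b <= e -> f e < (e - b) * m + gap_start b ->
    exists z i, [/\ z < ns, b <= i < e & held (W z) (sg z) (f e) = Some (f i)].
  move=> be lt_fe; have be' : b < e.
    rewrite ltn_neqAle be andbT; apply/eqP => eb; move: lt_fe.
    by rewrite eb subnn mul0n add0n; case: (e) eh => //= e' e'h; rewrite ltnNge f_mono.
  apply: good => //; rewrite mulnC.
  have : gap_start b <= f e.
    by case: (b) be' => [//|b'] /= /ltnW b'e; exact: f_mono.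
  lia.
pose alive i := [exists z : 'I_ns, held (W z) (sg z) (f e) == Some (f i)].
have aliveP z i : z < ns -> held (W z) (sg z) (f e) = Some (f i) -> alive i.
  by move=> zn hz; apply/existsP; exists (Ordinal zn); rewrite hz.
have [/existsP ex|/existsPn none] := boolP [exists i : 'I_e, alive i].
  have ex' : exists i, (i < e) && alive i.
    by case: ex => i ai; exists i; rewrite ltn_ord.
  have ub i : (i < e) && alive i -> i <= e by case/andP=> /ltnW.
  case: (ex_maxnP ex' ub) => i /andP[ie ai] imax.
  case/existsP: (ai) => z /eqP hz.
  have ih : i < h by apply: leq_trans eh.
  have lt_q := estimate_ge (ltn_ord z) hz (g_mono ie eh) (fg ih).
  have IHi := IH i ie (ltnW ih).
  (* As [i] is the latest remembered point, the window after it is not hit, hence not dense. Adding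
     the bound for [i] makes the times telescope. *)
  have le_fe : (e - i.+1) * m + (f i).+1 <= f e.
    rewrite leqNgt; apply/negP => lt_fe.
    have [z' [i' [zn /andP[ii' i'e] hz']]] := go i.+1 ie lt_fe.
    have := imax i'; rewrite i'e (aliveP _ _ zn hz') => /(_ isT).
    by rewrite leqNgt ii'.
  apply: leq_trans (_ : ((e - i.+1) + (i - estimate (f i) (g i))) * m <= _).
    by rewrite leq_mul2r; apply/orP; right; lia.
  rewrite mulnDl; lia.
apply: (@leq_trans (e * m)); first by rewrite leq_mul2r leq_subr orbT.
rewrite leqNgt; apply/negP => lt_fe.
have [||z [i [zn /andP[_ ie] hz]]] := go 0 => //; first by rewrite subn0 addn0.
by have := none (Ordinal ie); rewrite (aliveP _ _ zn hz).
Qed.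

End Chain.
End Estimate.

(** A sentinel with index [h] is placed at [(n, n)], past both strings, so that [chain_loss] at
    [e = h] speaks of the final query. *)
Lemma LCS_chain (S : eqType) (x0 : S) (x y : seq S) n :
  size x = n -> size y = n -> exists f g : nat -> nat,
  let h := LCS x y in
  [/\ (forall i i', i < i' -> i' <= h -> f i < f i'),
      (forall i i', i < i' -> i' <= h -> g i < g i'),
      (forall i, i < h -> nth x0 y (g i) = nth x0 x (f i)),
      f h = n & g h = n].
Proof.
move=> sx sy; have [u [ux uy su]] := LCS_witness x y.
have [f [fP f_mono]] := subseq_embedding x0 ux.
have [g [gP g_mono]] := subseq_embedding x0 uy.
exists (fun i => if i < size u then f i else n).
exists (fun i => if i < size u then g i else n).
rewrite /= -su ltnn; split=> // [i i' ii' i'u|i i' ii' i'u|i iu].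
- rewrite (leq_trans ii' i'u); case: (ltnP i' (size u)) => [i'h|_]; first exact: f_mono ii' i'h.
  by rewrite -sx; apply: (proj1 (fP _ _)); apply: leq_trans i'u.
- rewrite (leq_trans ii' i'u); case: (ltnP i' (size u)) => [i'h|_]; first exact: g_mono ii' i'h.
  by rewrite -sy; apply: (proj1 (gP _ _)); apply: leq_trans i'u.
- by rewrite iu (proj2 (fP _ iu)) (proj2 (gP _ iu)).
Qed.

(** * Probability trees *)

Section Trees.
Local Open Scope ring_scope.
Variable R : realType.
Implicit Types A B : Type.

Lemma bind_bind A B C (t : rtree A) (g : A -> rtree B) (h : B -> rtree C) :
  bind (bind t g) h = bind t (fun a => bind (g a) h).
Proof.
elim: t => [//|m f IH] /=; congr Choose.
by apply: functional_extensionality => i; apply: IH.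
Qed.

Lemma always_bind A B (P : B -> Prop) (t : rtree A) (g : A -> rtree B) :
  always (fun a => always P (g a)) t -> always P (bind t g).
Proof. by elim: t => [//|m f IH] /= H i; apply/IH/H. Qed.

Lemma always_imp A (P Q : A -> Prop) (t : rtree A) :
  (forall a, P a -> Q a) -> always P t -> always Q t.
Proof. by move=> PQ; elim: t => [a|m f IH] /= => [/PQ|H i]; last exact/IH/H. Qed.

Lemma uniform_bound (P : nat -> nat -> Prop) m :
  (forall i, (i < m)%N -> exists F, forall f, (F <= f)%N -> P f i) ->
  exists F, forall f, (F <= f)%N -> forall i, (i < m)%N -> P f i.
Proof.
elim: m => [|m IH] H; first by exists 0%N.
have [|F FP] := IH; first by move=> i im; apply: H; rewrite ltnW.
have [F' FP'] := H m (leqnn _).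
exists (maxn F F') => f; rewrite geq_max => /andP[Ff F'f] i.
by rewrite ltnS leq_eqVlt => /orP[/eqP->|]; [apply: FP' | apply: FP].
Qed.

(* Trees branch finitely, so pointwise termination gives a common fuel bound. *)
Lemma always_uniform A (P : nat -> A -> Prop) (t : rtree A) :
  always (fun a => exists F, forall f, (F <= f)%N -> P f a) t ->
  exists F, forall f, (F <= f)%N -> always (P f) t.
Proof.
elim: t => [a //|m f IH] /= H.
have [i im|F FP] := @uniform_bound (fun j i => always (P j) (f i)) m.+1.
  exact: (IH i (H (Ordinal im))).
by exists F => j Fj i; apply: FP.
Qed.

Lemma prob_ge0 A (p : pred A) t : 0 <= prob R p t.
Proof.
elim: t => [a|m f IH] /=; first exact: ler0n.
by apply: divr_ge0 => //; apply: sumr_ge0.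
Qed.

Lemma prob_always A (p : pred A) t : always p t -> prob R p t = 1.
Proof.
elim: t => [a /= ->//|m f IH] /= H.
under eq_bigr do rewrite (IH _ (H _)).
by rewrite sumr_const card_ord divff ?pnatr_eq0.
Qed.

Lemma prob_pred0 A (t : rtree A) : prob R xpred0 t = 0.
Proof.
elim: t => [a //|m f IH] /=.
by under eq_bigr do rewrite IH; rewrite sumr_const mul0rn mul0r.
Qed.

Lemma prob_predC A (p : pred A) t : prob R (fun a => ~~ p a) t = 1 - prob R p t.
Proof.
elim: t => [a|m f IH] /=; first by case: (p a); rewrite ?subrr ?subr0.
under eq_bigr do rewrite IH.
by rewrite sumrB sumr_const card_ord mulrBl divff ?pnatr_eq0.
Qed.

Lemma prob_union A I (p : I -> pred A) (r : seq I) t :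
  prob R (fun a => has (p^~ a) r) t <= \sum_(i <- r) prob R (p i) t.
Proof.
elim: t => [a|m f IH] /=.
  elim: r => [|i r IH]; first by rewrite big_nil.
  rewrite big_cons /=; case: (p i a) => //=; last by rewrite add0r.
  by rewrite lerDl; apply: le_trans IH; apply: ler0n.
rewrite -mulr_suml exchange_big /= ler_pM2r ?invr_gt0 ?ltr0n //.
by apply: ler_sum => i _; apply: IH.
Qed.

Lemma prob_bind_ret A B (p : pred B) (g : A -> B) t :
  prob R p (bind t (fun a => Ret (g a))) = prob R (fun a => p (g a)) t.
Proof. by elim: t => [//|m f IH] /=; under eq_bigr do rewrite IH. Qed.

Lemma prob_bind_ge A B (p : pred A) (q : pred B) (g : A -> rtree B) t :
  always (fun a => p a -> always q (g a)) t ->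
  prob R p t <= prob R q (bind t g).
Proof.
elim: t => [a|m f IH] /= H; last first.
  by rewrite ler_pM2r ?invr_gt0 ?ltr0n //; apply: ler_sum => i _; apply/IH/H.
case: (p a) H => [/(_ isT) /prob_always->//|_]; exact: prob_ge0.
Qed.

Fixpoint draw_all (ws : seq nat) : rtree (seq nat) :=
  if ws is w :: ws' then
    Choose w.-1 (fun a => bind (draw_all ws') (fun l => Ret (a :: l)))
  else Ret [::].

Lemma always_draw_all ws : all (ltn 0) ws ->
  always (fun l => all2 (fun w a => (a < w)%N) ws l) (draw_all ws).
Proof.
elim: ws => //= w ws IH /andP[w0 /IH H] i; apply: always_bind.
by apply: always_imp H => l /= ->; rewrite andbT -{2}(prednK w0).
Qed.

(** Independence of the draws; [w.-1.+1] is the number of branches of [Choose w.-1], equal to [w]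
    for positive [w]. *)
Lemma prob_draw_all (B : nat -> pred nat) ws :
  prob R (all2 B ws) (draw_all ws)
  = \prod_(w <- ws) ((\sum_(a < w.-1.+1) (B w a)%:R) / w.-1.+1%:R).
Proof.
elim: ws => [|w ws IH] /=; first by rewrite big_nil.
rewrite big_cons -IH mulrAC [in RHS]mulr_suml; congr (_ / _).
apply: eq_bigr => a _; rewrite prob_bind_ret /=.
by case: (B w a); rewrite ?mul1r //= mul0r prob_pred0.
Qed.
End Trees.

(** * Weakest preconditions for deterministic commands *)

Definition reg (r : nat) : expr := Cell (Lit r).

Definition for_ (r : nat) (bound : expr) (body : cmd) : cmd :=
  Seq (Assign (Lit r) (Lit 0))
      (While (Le (Add (reg r) (Lit 1)) bound)
             (Seq body (Assign (Lit r) (Add (reg r) (Lit 1))))).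

(* Cells 0 to 15 are registers: 0 = output, 1 = m, 2 = lev, 3 = number of      *)
(* slots, 4 = slot, 5 = width, 6 = time, 7 = position in y, 8 and 10 =        *)
(* occurrence counters, 9 = inner loop index, 11 = running maximum, 12 = x_T. *)
(* Slot [z] has its seed at offset 0, its width at 1, its symbol at 2 (an     *)
(* integer while it is empty) and the estimate for the [c]-th occurrence of   *)
(* the symbol in y at [3 + c]. One slot past the last is a scratch column.    *)
Definition adr (k z o : nat) : nat := 16 + (z * (k + 3) + o).

Definition adrE (z o : expr) : expr :=
  Add (Lit 16) (Add (Mul z (Add ParK (Lit 3))) o).

Lemma adr_reg k z o r : r < 16 -> (adr k z o == r) = false.
Proof. by rewrite /adr; lia. Qed.

Lemma reg_adr k z o r : r < 16 -> (r == adr k z o) = false.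
Proof. by rewrite /adr; lia. Qed.

Lemma adr_eq k z o z' o' : o < k + 3 -> o' < k + 3 ->
  (adr k z o == adr k z' o') = (z == z') && (o == o').
Proof.
rewrite /adr eqn_add2l => ok ok'.
apply/eqP/andP => [E|[/eqP-> /eqP->//]].
have k3 : 0 < k + 3 by lia.
have := congr1 (fun a => a %/ (k + 3)) E; have := congr1 (fun a => a %% (k + 3)) E.
by rewrite /= !modnMDl !divnMDl // !modn_small // !divn_small // !addn0 => -> ->.
Qed.

Lemma adr_lt k z o z' : o < k + 3 -> z <= z' -> adr k z o < adr k z' (k + 3).
Proof. by rewrite /adr => ok zz; rewrite ltn_add2l -addnS leq_add ?leq_mul. Qed.

Section Wp.
Variables (R : realType) (S : eqType) (w : input R S) (sp wd : nat).
Implicit Types (s : state S) (Q : state S -> Prop).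

Definition get s (a : nat) : cell S := nth (inl 0) (memory s) a.

Lemma get_write s a v b : get (write s a v) b = if b == a then v else get s b.
Proof. by rewrite /get /write /= nth_set_nth. Qed.

Lemma int_inl (i : nat) : int_of (inl i : cell S) = i. Proof. by []. Qed.
Lemma eval_lit s i : eval w s (Lit i) = inl i. Proof. by []. Qed.
Lemma eval_n s : eval w s ParN = inl (len_in w). Proof. by []. Qed.
Lemma eval_reg s r : eval w s (reg r) = get s r. Proof. by []. Qed.
Lemma eval_cell s e : eval w s (Cell e) = get s (int_of (eval w s e)).
Proof. by []. Qed.
Lemma eval_add s e e' :
  eval w s (Add e e') = inl (int_of (eval w s e) + int_of (eval w s e')).
Proof. by []. Qed.
Lemma eval_sub s e e' :
  eval w s (Defs.Sub e e') = inl (int_of (eval w s e) - int_of (eval w s e')).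
Proof. by []. Qed.
Lemma eval_mul s e e' :
  eval w s (Mul e e') = inl (int_of (eval w s e) * int_of (eval w s e')).
Proof. by []. Qed.
Lemma eval_div s e e' :
  eval w s (Div e e') = inl (int_of (eval w s e) %/ int_of (eval w s e')).
Proof. by []. Qed.
Lemma eval_adr s z o : eval w s (adrE z o) =
  inl (adr (mult_in w) (int_of (eval w s z)) (int_of (eval w s o))).
Proof. by []. Qed.

Definition evalE := (eval_lit, eval_n, eval_reg, eval_adr, eval_add, eval_sub,
  eval_mul, eval_div, eval_cell, int_inl).

Lemma exec_seq g c c' s : exec w g.+1 (Seq c c') s =
  bind (exec w g c s) (fun o => if o is Some s' then exec w g c' s' else Ret None).
Proof. by []. Qed.

Lemma exec_if g b c c' s :
  exec w g.+1 (If b c c') s = exec w g (if holds w s b then c else c') s.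
Proof. by []. Qed.

Lemma exec_while g b c s : exec w g.+1 (While b c) s =
  if holds w s b then
    bind (exec w g c s) (fun o => if o is Some s' then exec w g (While b c) s' else Ret None)
  else Ret (Some s).
Proof. by []. Qed.

Definition within s : Prop := size (memory s) <= sp /\ peak s <= wd.

Lemma within_write s a v :
  within s -> a < sp -> int_of v <= wd -> within (write s a v).
Proof.
case=> sz pk a_sp v_wd; split=> /=; last by rewrite geq_max pk.
by rewrite size_set_nth geq_max a_sp.
Qed.

(** Total correctness for commands without random draws. The result is the same for all fuel from
    [F] on, so the needs of subcommands can be added. Carrying [within] along yields the space bound
    with the result. *)
Definition wp (c : cmd) Q s : Prop := within s -> exists F s',
  [/\ forall f, exec w (F + f) c s = Ret (Some s'), within s' & Q s'].

Lemma wp_imp c Q Q' s : (forall s', Q s' -> Q' s') -> wp c Q s -> wp c Q' s.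
Proof.
by move=> QQ H /H [F [s' [e i q]]]; exists F, s'; split=> //; apply: QQ.
Qed.

Lemma wp_skip Q s : Q s -> wp Skip Q s.
Proof. by move=> q i; exists 1, s. Qed.

Lemma wp_assign a e Q s (b := int_of (eval w s a)) (v := eval w s e) :
  b < sp -> int_of v <= wd -> Q (write s b v) -> wp (Assign a e) Q s.
Proof.
by move=> bs vw q i; exists 1, (write s b v); split=> //; apply: within_write.
Qed.

Lemma wp_set r e v Q s : r < sp -> eval w s e = v -> int_of v <= wd ->
  Q (write s r v) -> wp (Assign (Lit r) e) Q s.
Proof. by move=> rs <- vw q; apply: wp_assign. Qed.

Lemma wp_seq c c' Q s : wp c (wp c' Q) s -> wp (Seq c c') Q s.
Proof.
move=> H /H [F [s' [e i /(_ i) [F' [s'' [e' i' q]]]]]].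
exists (F + F').+1, s''; split=> // f; rewrite addSn /= -addnA e /=.
by rewrite addnCA e'.
Qed.

Lemma wp_if b c c' Q s :
  wp (if holds w s b then c else c') Q s -> wp (If b c c') Q s.
Proof.
by move=> H /H [F [s' [e i q]]]; exists F.+1, s'; split=> // f; rewrite addSn /= e.
Qed.

Lemma wp_while (I : state S -> Prop) (mu : state S -> nat) b c Q s :
  (forall s, I s -> holds w s b -> wp c (fun s' => I s' /\ mu s' < mu s) s) ->
  (forall s, I s -> ~~ holds w s b -> Q s) ->
  I s -> wp (While b c) Q s.
Proof.
move=> body exit; move: {2}(mu s).+1 (leqnn (mu s).+1) => d.
elim: d s => // d IH s sd Is i.
case hb: (holds w s b); last first.
  exists 1, s; split=> // [f|]; first by rewrite add1n /= hb.
  by apply: exit; rewrite ?hb.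
have [F [s' [e i' [Is' lt_mu]]]] := body s Is hb i.
have [|F' [s'' [e' i'' q]]] := IH s' _ Is' i'; first by lia.
exists (F + F').+1, s''; split=> // f; rewrite addSn /= hb -addnA e /=.
by rewrite addnCA e'.
Qed.

(** The loop re-evaluates [bound] at every turn, so the invariant must fix its value; the body must
    preserve the counter, and the invariant is restored only after the increment. *)
Lemma wp_for (I : nat -> state S -> Prop) N r bound body Q s :
  r < sp -> N <= wd ->
  (forall v s, v <= N -> I v s -> int_of (eval w s bound) = N) ->
  I 0 (write s r (inl 0)) ->
  (forall v s, v < N -> get s r = inl v -> I v s ->
     wp body (fun s' => get s' r = inl v /\ I v.+1 (write s' r (inl v.+1))) s) ->
  (forall s, get s r = inl N -> I N s -> Q s) ->
  wp (for_ r bound body) Q s.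
Proof.
move=> rs Nw boundE I0 step exit; apply: wp_seq; apply: wp_set => //.
pose J s := exists2 v, v <= N & get s r = inl v /\ I v s.
apply: (wp_while (I := J) (mu := fun s => N - int_of (get s r))).
- move=> s1 [v vN [sr Iv]].
  rewrite /= -/(get s1 r) (boundE v) // sr /= addn1 => v_lt.
  apply: wp_seq; apply: wp_imp (step v s1 v_lt sr Iv) => s2 [s2r Iv'].
  apply: wp_set => //; rewrite ?evalE ?s2r ?int_inl ?addn1 //=.
    by apply: leq_trans Nw.
  split; first by exists v.+1; rewrite ?get_write ?eqxx.
  by rewrite get_write eqxx /=; lia.
- move=> s1 [v vN [sr Iv]].
  rewrite /= -/(get s1 r) (boundE v) // sr /= addn1 -leqNgt => Nv.
  have vE : v = N by lia.
  by apply: exit; rewrite -vE.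
- by exists 0 => //; rewrite get_write eqxx.
Qed.

(** Frame condition: [L] lists the only cells that may have changed. *)
Definition same s0 s (L : seq nat) : Prop :=
  stream s = stream s0 /\ forall a, a \notin L -> get s a = get s0 a.

Lemma same_refl s L : same s s L. Proof. by []. Qed.

Lemma same_write s0 s L a v : a \in L -> same s0 s L -> same s0 (write s a v) L.
Proof.
move=> aL [st g]; split=> // b bL; rewrite get_write g //.
by case: eqP bL => // ->; rewrite aL.
Qed.

Lemma same_trans s1 s0 s2 L1 L2 : all [in L1] L2 ->
  same s0 s1 L1 -> same s1 s2 L2 -> same s0 s2 L1.
Proof.
move=> LL [st g] [st' g']; split; first by rewrite st' st.
by move=> a aL; rewrite g' ?g //; apply: contra aL => /(allP LL).
Qed.

End Wp.

Lemma same_adr (S : eqType) (s0 s : state S) L k z o : all (ltn^~ 16) L ->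
  same s0 s L -> get s (adr k z o) = get s0 (adr k z o).
Proof.
move=> L16 [_ ->] //; apply/negP => /(allP L16); rewrite /adr /=; lia.
Qed.

(** * The streaming program *)

Definition sym_at (z : expr) : expr := Cell (adrE z (Lit 2)).
Definition val_at (z c : expr) : expr := Cell (adrE z (Add (Lit 3) c)).
Definition incr (r : nat) : cmd := Assign (Lit r) (Add (reg r) (Lit 1)).

(** With truncated subtraction, [a + (v - a)] is the maximum of [a] and [v]. Register 10 counts the
    earlier occurrences in [y] of the symbol of the slot, which is the index into its column. *)
Definition query_slot : cmd :=
  Seq (Assign (Lit 10) (Lit 0))
      (for_ 9 (reg 7)
        (If (Eq (Y (reg 9)) (sym_at (reg 4)))
            (Seq (Assign (Lit 11)
                   (Add (reg 11) (Defs.Sub (val_at (reg 4) (reg 10)) (reg 11))))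
                 (incr 10))
            Skip)).

Definition query : cmd :=
  Seq (Assign (Lit 11) (Lit 0)) (for_ 4 (reg 3) query_slot).

(** Every estimate of the new column queries all slots, so the column is built in the scratch slot
    and no old column is overwritten before the last query. *)
Definition fill_column : cmd :=
  Seq (Assign (Lit 8) (Lit 0))
      (for_ 7 ParN
        (If (Eq (Y (reg 7)) (reg 12))
            (Seq query
            (Seq (Assign (adrE (reg 3) (Add (Lit 3) (reg 8))) (Add (reg 11) (Lit 1)))
                 (incr 8)))
            Skip)).

Definition width_at (z : expr) : expr := Cell (adrE z (Lit 1)).

Definition copy_slot : cmd :=
  Seq (Assign (adrE (reg 4) (Lit 2)) (reg 12))
      (for_ 9 (reg 8)
        (Assign (adrE (reg 4) (Add (Lit 3) (reg 9))) (val_at (reg 3) (reg 9)))).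

(** The subtraction computes the time modulo the width, for lack of a remainder operation in the
    machine. *)
Definition copy_column : cmd :=
  for_ 4 (reg 3)
    (If (Eq (Defs.Sub (reg 6)
               (Mul (Div (reg 6) (width_at (reg 4))) (width_at (reg 4))))
            (Cell (adrE (reg 4) (Lit 0))))
        copy_slot Skip).

Definition stream_loop : cmd :=
  for_ 6 ParN (Seq (ReadX (Lit 12)) (Seq fill_column copy_column)).

Definition finish : cmd :=
  Seq (Assign (Lit 7) ParN)
      (Seq query (Assign (Lit 0) (Defs.Sub ParN (reg 11)))).

Section Program.
Variables (R : realType) (S : eqType) (x0 : S) (delta : R) (n k : nat).
Variables (x y : seq S) (ns : nat) (W sg : nat -> nat) (sp wd : nat).
Let w := Input delta n k y.
Hypotheses (sx : size x = n) (sy : size y = n).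
Hypothesis y_mult : forall a, count_mem a y <= k.
Hypotheses (sp_ge : adr k ns (k + 3) <= sp) (n_wd : n <= wd) (ns_wd : ns <= wd).
Implicit Types s : state S.

Let est := estimate x0 x y ns W sg.
Let best := slot_best x0 x y ns W sg.
Let xs t := nth x0 x t.
Let ys i := nth x0 y i.
Let holding z T := held (W z) (sg z) T.
Let occ (a : S) i := count_mem a (take i y).

(** Cells are indexed by the rank of [i] among the occurrences of the symbol, so [k] cells suffice.
    The stored value is the estimate before the match plus one for the match itself. *)
Definition column s z t : Prop := forall i, i < n -> ys i = xs t ->
  get s (adr k z (3 + occ (xs t) i)) = inl (est t i).+1.

Definition slot_ok s z (o : option nat) : Prop :=
  if o is Some t then get s (adr k z 2) = inr (xs t) /\ column s z t
  else get s (adr k z 2) = inl 0.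

Definition slots_ok s T : Prop := forall z, z < ns ->
  [/\ get s (adr k z 0) = inl (sg z), get s (adr k z 1) = inl (W z)
    & slot_ok s z (holding z T)].

Lemma reg_lt r : r < 16 -> r < sp.
Proof. by move=> r16; apply: leq_trans sp_ge; rewrite /adr; lia. Qed.

Lemma occS a i : i < n -> occ a i.+1 = occ a i + (ys i == a).
Proof.
by move=> i_n; rewrite /occ (take_nth x0) ?sy // -cats1 count_cat /= addn0.
Qed.

Lemma occ_le a i : occ a i <= i.
Proof. by apply: leq_trans (count_size _ _) _; rewrite size_take; case: ltnP. Qed.

Lemma occ_lt i : i < n -> occ (ys i) i < k.
Proof.
move=> i_n; apply: leq_trans (y_mult (ys i)).
by rewrite -[y in leqRHS](cat_take_drop i.+1) count_cat -/(occ _ _) occS // eqxx; lia.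
Qed.

Lemma est_lt t i : t < n -> i < n -> est t i < n.
Proof.
move=> tn i_n; apply: leq_ltn_trans (tn).
by apply: estimate_le; rewrite ?sx ?sy; apply: ltnW.
Qed.

Lemma best0 o : best o 0 = 0.
Proof. by case: o => //= t; rewrite big_ord0. Qed.

Lemma bestS t i :
  best (Some t) i.+1 = maxn (best (Some t) i) (if ys i == xs t then (est t i).+1 else 0).
Proof. by rewrite /best /= !(big_mkcond (fun i => _ == _)) big_ord_recr. Qed.

Lemma best_le z T j : T <= n -> j <= n -> best (holding z T) j <= n.
Proof.
move=> Tn jn; rewrite /best; case E : (holding z T) => [t|] //=.
move/held_lt: E => tT; apply/bigmax_leqP => i _.
by apply: est_lt; [apply: leq_trans Tn | apply: leq_trans jn].
Qed.

Lemma eval_Y s e : int_of (eval w s e) < n ->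
  eval w s (Y e) = inr (ys (int_of (eval w s e))).
Proof. by move=> lt; rewrite /= (nth_map x0) ?sy. Qed.

Lemma wp_query_slot s0 Q z T j v0 : z < ns -> T <= n -> j <= n -> v0 <= n ->
  slot_ok s0 z (holding z T) ->
  get s0 4 = inl z -> get s0 7 = inl j -> get s0 11 = inl v0 ->
  (forall s, same s0 s [:: 9; 10; 11] ->
     get s 11 = inl (maxn v0 (best (holding z T) j)) -> Q s) ->
  wp w sp wd query_slot Q s0.
Proof.
move=> zn Tn jn v0n ok s4 s7 s11 post.
apply/wp_seq/(@wp_set _ _ _ _ _ _ _ (inl 0)); rewrite ?reg_lt //.
set o := holding z T in ok post *.
apply: (@wp_for _ _ _ _ _ (fun i s => [/\ same s0 s [:: 9; 10; 11],
    get s 10 = inl (if o is Some t then occ (xs t) i else 0)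
  & get s 11 = inl (maxn v0 (best o i))]) j); rewrite ?reg_lt ?(leq_trans jn) //.
- move=> i s _ [sm _ _]; rewrite evalE.
  by rewrite (proj2 sm) // s7.
- rewrite !get_write /= s11 best0 maxn0; split=> //.
    by do 2 apply: same_write => //; apply: same_refl.
  by case: (o) => // t; rewrite /occ take0.
- move=> i s ij s9 [sm s10 s11']; apply: wp_if.
  have i_n : i < n by apply: leq_trans jn.
  (* An empty slot holds the integer 0 in place of a symbol, which equals no symbol of [y]; it
     contributes nothing to the maximum. *)
  have -> : holds w s (Eq (Y (reg 9)) (sym_at (reg 4))) =
     if o is Some t then ys i == xs t else false.
    rewrite [LHS]/(eval w s (Y (reg 9)) == eval w s (sym_at (reg 4))).
    rewrite eval_Y !evalE s9 ?(proj2 sm 4) // s4 /= (@same_adr _ s0 _ [:: 9; 10; 11]) //.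
    by move: ok; rewrite /slot_ok; case: (o) => [t [-> _]|->].
  have skip : best o i.+1 = best o i -> 
       get s 10 = inl (if o is Some t then occ (xs t) i.+1 else 0) ->
       wp w sp wd Skip (fun s' => get s' 9 = inl i /\
   [/\ same s0 (write s' 9 (inl i.+1)) [:: 9; 10; 11],
       get (write s' 9 (inl i.+1)) 10 =
       inl (match o with Some t => occ (xs t) i.+1 | None => 0 end)
     & get (write s' 9 (inl i.+1)) 11 = inl (maxn v0 (best o i.+1))]) s.
    move=> bE s10'; apply: wp_skip; split=> //; rewrite !get_write /= bE.
    by split=> //; apply: same_write.
  move: ok; rewrite /slot_ok.
  case E : o => [t|] in s10 s11' skip * => [[sym col]|_]; last first.
    by apply: skip.
  have tT := held_lt E.
  case yx: (ys i == xs t); last first.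
    by apply: skip; rewrite ?bestS ?yx ?maxn0 // occS // yx addn0.
  have := col i i_n (eqP yx) => val_i.
  have occ_k : occ (xs t) i < k by rewrite -(eqP yx) occ_lt.
  have lt_est : est t i < n by apply: est_lt => //; apply: leq_trans Tn.
  have best_n : best (Some t) i.+1 <= n.
    by rewrite -E; apply: best_le => //; apply: leq_trans jn.
  apply/wp_seq/(@wp_set _ _ _ _ _ _ _ (inl (maxn v0 (best (Some t) i.+1)))).
  + by rewrite reg_lt.
  + rewrite /val_at !evalE (proj2 sm 4) // s4 s10 !int_inl.
    rewrite (@same_adr _ s0 _ [:: 9; 10; 11]) // val_i s11' !int_inl.
    by rewrite -maxnE -maxnA bestS yx.
  + by rewrite int_inl; lia.
  apply: (@wp_set _ _ _ _ _ _ _ (inl (occ (xs t) i.+1))).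
  + by rewrite reg_lt.
  + by rewrite !evalE get_write /= s10 occS // yx.
  + by have := occ_le (xs t) i.+1; rewrite int_inl; lia.
  rewrite !get_write /=; split=> //; split=> //.
  by do 3 apply: same_write => //.
- by move=> s _ [sm _ s11']; apply: post.
Qed.

Lemma wp_query s0 Q T j : T <= n -> j <= n -> slots_ok s0 T ->
  get s0 3 = inl ns -> get s0 7 = inl j ->
  (forall s, same s0 s [:: 4; 9; 10; 11] -> get s 11 = inl (est T j) -> Q s) ->
  wp w sp wd query Q s0.
Proof.
move=> Tn jn ok s3 s7 post.
apply/wp_seq/(@wp_set _ _ _ _ _ _ _ (inl 0)); rewrite ?reg_lt //.
apply: (@wp_for _ _ _ _ _ (fun z s => same s0 s [:: 4; 9; 10; 11] /\
  get s 11 = inl (\max_(z' < z) best (holding z' T) j)) ns); rewrite ?reg_lt //.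
- by move=> z s _ [sm _]; rewrite evalE (proj2 sm) // s3.
- rewrite !get_write big_ord0; split=> //.
  by do 2 apply: same_write => //; apply: same_refl.
- move=> z s zn s4 [sm s11].
  have [_ _ okz] := ok z zn.
  apply: (wp_query_slot zn Tn jn _ _ s4 _ s11).
  + by apply/bigmax_leqP => z' _; apply: best_le.
  + move: okz; rewrite /slot_ok /column; case: (holding z T) => [t|].
      case=> sym col; rewrite (@same_adr _ s0 _ [:: 4; 9; 10; 11]) //; split=> // i i_n yx.
      by rewrite (@same_adr _ s0 _ [:: 4; 9; 10; 11]) // col.
    by rewrite (@same_adr _ s0 _ [:: 4; 9; 10; 11]).
  + by rewrite (proj2 sm).
  move=> s1 sm1 s11'; split; first by rewrite (proj2 sm1).
  split; last by rewrite get_write /= big_ord_recr.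
  by apply: same_write => //; apply: same_trans sm sm1.
- move=> s _ [sm s11]; apply: post => //.
  by rewrite s11 /est estimateE.
Qed.


Lemma slot_ok_eq s s' z o :
  (forall d, 2 <= d -> d < k + 3 -> get s' (adr k z d) = get s (adr k z d)) ->
  slot_ok s z o -> slot_ok s' z o.
Proof.
move=> eq_s; have k3 : 2 < k + 3 by lia.
rewrite /slot_ok /column; case: o => [t|]; rewrite eq_s //.
case=> sym col; split=> // i i_n yx; rewrite eq_s ?col //.
by rewrite addnC ltn_add2r -yx occ_lt.
Qed.

Lemma slots_ok_eq s s' T :
  (forall z d, z < ns -> d < k + 3 -> get s' (adr k z d) = get s (adr k z d)) ->
  slots_ok s T -> slots_ok s' T.
Proof.
move=> eq_s ok z zn; have [seed wid okz] := ok z zn.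
split; rewrite ?eq_s //; try lia.
by apply: slot_ok_eq okz => d _ dk; apply: eq_s.
Qed.

Definition ctx s T (st : seq S) : Prop :=
  [/\ get s 3 = inl ns, get s 6 = inl T, get s 12 = inr (xs T) & stream s = st].

Lemma ctx_same s s' T st L : same s s' L ->
  3 \notin L -> 6 \notin L -> 12 \notin L -> ctx s T st -> ctx s' T st.
Proof. by move=> [str g] h3 h6 h12 [c3 c6 c12 cs]; split; rewrite ?g ?str. Qed.

(** State of the scratch column when the positions of [y] below [j] are done. The last clause bounds
    the integers that [copy_slot] will write again. *)
Definition temp_ok s T j : Prop :=
  [/\ get s 8 = inl (occ (xs T) j),
      forall i, i < j -> ys i = xs T ->
        get s (adr k ns (3 + occ (xs T) i)) = inl (est T i).+1
    & forall c, c < occ (xs T) j -> int_of (get s (adr k ns (3 + c))) <= n].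

Lemma occ_leq_k a j : occ a j <= k.
Proof.
by apply: leq_trans (y_mult a); rewrite -[y in leqRHS](cat_take_drop j) count_cat leq_addr.
Qed.

Lemma wp_fill_column s0 Q T st : T < n -> slots_ok s0 T -> ctx s0 T st ->
  (forall s, slots_ok s T -> ctx s T st -> temp_ok s T n -> Q s) ->
  wp w sp wd fill_column Q s0.
Proof.
move=> Tn ok0 cx0 post.
apply/wp_seq/(@wp_set _ _ _ _ _ _ _ (inl 0)); rewrite ?reg_lt //.
apply: (@wp_for _ _ _ _ _ (fun j s => [/\ slots_ok s T, ctx s T st & temp_ok s T j]) n);
  rewrite ?reg_lt //.
- split.
  + by apply: slots_ok_eq ok0 => z d _ _; rewrite !get_write !adr_reg.
  + by apply: (ctx_same (s := s0) (L := [:: 7; 8])) cx0 => //; do 2 apply: same_write => //; apply: same_refl.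
  + by split; rewrite ?get_write //= /occ take0.
- move=> j s jn s7 [ok cx [s8 vals bnd]]; have [c3 c6 c12 cst] := cx.
  have keep7 s' : slots_ok s' T -> ctx s' T st -> temp_ok s' T j.+1 ->
      let s'' := write s' 7 (inl j.+1) in
      [/\ slots_ok s'' T, ctx s'' T st & temp_ok s'' T j.+1].
    move=> ok' cx' [h8 hv hb]; split.
    + by apply: slots_ok_eq ok' => z d _ _; rewrite !get_write !adr_reg.
    + by apply: (ctx_same (s := s') (L := [:: 7])) cx' => //; apply: same_write => //; apply: same_refl.
    + split; first by rewrite get_write.
        by move=> i ij yx; rewrite get_write adr_reg // hv.
      by move=> c c_lt; rewrite get_write adr_reg // hb.
  apply: wp_if.
  have -> : holds w s (Eq (Y (reg 7)) (reg 12)) = (ys j == xs T).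
    rewrite [LHS]/(eval w s (Y (reg 7)) == eval w s (reg 12)).
    by rewrite eval_Y !evalE s7 // c12.
  case yx: (ys j == xs T); last first.
    apply: wp_skip; split=> //; apply: keep7 => //; split.
    + by rewrite occS // yx addn0.
    + move=> i; rewrite ltnS leq_eqVlt => /orP[/eqP->|/vals//].
      by move/eqP; rewrite yx.
    + by rewrite occS // yx addn0.
  have occ_k : occ (xs T) j < k by rewrite -(eqP yx) occ_lt.
  have lt_est := est_lt Tn jn.
  apply/wp_seq/(wp_query (ltnW Tn) (ltnW jn) ok c3 s7) => s1 sm s11.
  have sm_adr z d : get s1 (adr k z d) = get s (adr k z d).
    by rewrite (@same_adr _ s _ [:: 4; 9; 10; 11]).
  have s1r r : r \notin [:: 4; 9; 10; 11] -> get s1 r = get s r by move=> h; apply: (proj2 sm).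
  have aE : int_of (eval w s1 (adrE (reg 3) (Add (Lit 3) (reg 8))))
      = adr k ns (3 + occ (xs T) j).
    by rewrite !evalE !s1r // c3 s8 !int_inl.
  have vE : eval w s1 (Add (reg 11) (Lit 1)) = inl (est T j).+1.
    by rewrite !evalE s11 int_inl addn1.
  apply/wp_seq/wp_assign; rewrite ?aE ?vE ?int_inl.
  + by apply: leq_trans sp_ge; apply: adr_lt => //; lia.
  + by apply: leq_trans n_wd.
  apply: (@wp_set _ _ _ _ _ _ _ (inl (occ (xs T) j.+1))).
  + by rewrite reg_lt.
  + by rewrite !evalE get_write reg_adr // s1r // s8 int_inl occS // yx.
  + by have := occ_le (xs T) j.+1; rewrite int_inl; lia.
  split; first by rewrite !get_write reg_adr //= s1r.
  apply: keep7; last split.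
  + apply: slots_ok_eq ok => z d zn dk; rewrite !get_write adr_reg //.
    by rewrite adr_eq ?sm_adr ?(ltn_eqF zn) //; lia.
  + by split; rewrite 2?get_write /= ?reg_adr ?s1r // (proj1 sm).
  + by rewrite get_write.
  + move=> i; rewrite ltnS leq_eqVlt !get_write adr_reg // => /orP[/eqP-> _|ij yxi].
      by rewrite eqxx.
    (* Ranks increase strictly along matching positions, so the new cell differs from those already
       filled. *)
    have occ_ij : occ (xs T) i < occ (xs T) j.
      apply: (@leq_trans (occ (xs T) i.+1)).
        by rewrite occS ?yxi ?eqxx ?addn1 //; apply: ltn_trans jn.
      rewrite /occ -(subnKC ij) takeD count_cat; exact: leq_addr.
    rewrite adr_eq; [|lia..]; rewrite eqn_add2l (ltn_eqF occ_ij) andbF sm_adr.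
    exact: vals.
  + move=> c; rewrite occS // yx addn1 ltnS leq_eqVlt !get_write adr_reg //.
    case: eqP => [->|_] /= c_lt; first by rewrite eqxx int_inl.
    rewrite adr_eq; [|lia..]; rewrite eqn_add2l (ltn_eqF c_lt) andbF sm_adr.
    exact: bnd.
- by move=> s _ [ok cx tmp]; apply: post.
Qed.

Lemma wp_copy_slot s0 Q T st z : T < n -> z < ns -> get s0 4 = inl z ->
  ctx s0 T st -> temp_ok s0 T n ->
  (forall s, stream s = st ->
     (forall a, a != 9 -> (forall d, 2 <= d -> d < k + 3 -> a != adr k z d) ->
        get s a = get s0 a) ->
     slot_ok s z (Some T) -> Q s) ->
  wp w sp wd copy_slot Q s0.
Proof.
move=> Tn zn s4 [c3 c6 c12 cst] [s8 vals bnd] post.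
have aE : int_of (eval w s0 (adrE (reg 4) (Lit 2))) = adr k z 2.
  by rewrite !evalE s4 int_inl.
apply/wp_seq/wp_assign; rewrite ?aE ?evalE ?c12 //.
  by apply: leq_trans sp_ge; apply: adr_lt; rewrite ?(ltnW zn) //; lia.
set s1 := write s0 _ _.
have zns d d' : d < k + 3 -> d' < k + 3 -> (adr k ns d == adr k z d') = false.
  by move=> dk dk'; rewrite adr_eq // (gtn_eqF zn).
have occ_n := occ_leq_k (xs T) n.
apply: (@wp_for _ _ _ _ _ (fun i s => [/\ stream s = st,
   (forall a, a != 9 -> (forall d, 2 < d -> d < k + 3 -> a != adr k z d) ->
     get s a = get s1 a)
 & forall c, c < i -> get s (adr k z (3 + c)) = get s0 (adr k ns (3 + c))])
  (occ (xs T) n)); rewrite ?reg_lt //.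
- exact: leq_trans (occ_le _ _) n_wd.
- move=> i s _ [_ g _]; rewrite evalE g //; first by rewrite /s1 get_write reg_adr // s8.
- split; [exact: cst | by move=> a /negbTE a9 _; rewrite get_write a9 | by []].
- move=> i s i_lt s9 [str g cp].
  have k0 : i < k by apply: leq_trans occ_n.
  have gr r : r < 9 -> get s r = get s0 r.
    move=> r9; have r16 : r < 16 by apply: leq_trans r9 _.
    rewrite g; first by rewrite /s1 get_write reg_adr.
      by rewrite ltn_eqF.
    by move=> d _ _; rewrite reg_adr.
  have vE : eval w s (val_at (reg 3) (reg 9)) = get s0 (adr k ns (3 + i)).
    rewrite !evalE (gr 3) // c3 s9 !int_inl /=.
    rewrite g; first by rewrite /s1 get_write zns //; lia.
      by rewrite adr_reg.
    by move=> d d2 dk; rewrite zns //; lia.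
  have bE : int_of (eval w s (adrE (reg 4) (Add (Lit 3) (reg 9)))) = adr k z (3 + i).
    by rewrite !evalE (gr 4) // s4 s9 !int_inl.
  apply: wp_assign; rewrite ?bE ?vE.
  + by apply: leq_trans sp_ge; apply: adr_lt; rewrite ?(ltnW zn) //; lia.
  + by apply: leq_trans (bnd _ i_lt) n_wd.
  split; first by rewrite get_write reg_adr.
  split=> [//|a a9 az|c].
    have a_neq : a != adr k z (3 + i) by apply: az; lia.
    by rewrite 2!get_write (negbTE a9) (negbTE a_neq) g.
  rewrite ltnS leq_eqVlt !get_write adr_reg // => c_i.
  have ci : c <= i by case/orP: c_i => [/eqP->|/ltnW].
  rewrite adr_eq; [|lia..]; rewrite eqxx eqn_add2l /=.
  by case: eqP c_i => [->//|_] /= /cp.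
- move=> s _ [str g cp]; apply: post => //.
    move=> a a9 az; rewrite g // => [|d d2 dk].
      have a_neq : a != adr k z 2 by apply: az; lia.
      by rewrite /s1 get_write (negbTE a_neq).
    by rewrite az // ltnW.
  split.
    rewrite g ?adr_reg // => [|d d2 dk]; first by rewrite /s1 get_write eqxx.
    by rewrite adr_eq; [rewrite eqxx; lia | lia | lia].
  move=> i i_n yx; rewrite cp; first exact: vals.
  apply: (@leq_trans (occ (xs T) i.+1)); first by rewrite occS // yx eqxx addn1.
  by rewrite /occ -(subnKC i_n) takeD count_cat; apply: leq_addr.
Qed.

Lemma wp_copy_column s0 Q T st : T < n -> slots_ok s0 T -> ctx s0 T st ->
  temp_ok s0 T n ->
  (forall s, slots_ok s T.+1 -> get s 3 = inl ns -> get s 6 = inl T ->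
     stream s = st -> Q s) ->
  wp w sp wd copy_column Q s0.
Proof.
move=> Tn ok0 cx0 tmp0 post.
(* During the sweep the slots below [z] are already at time [T.+1], the others still at time [T]. *)
pose upto z s := forall z', z' < ns ->
  [/\ get s (adr k z' 0) = inl (sg z'), get s (adr k z' 1) = inl (W z')
    & slot_ok s z' (holding z' (if z' < z then T.+1 else T))].
have keep s s' z : (forall a, a != 4 -> get s' a = get s a) -> stream s' = stream s ->
  [/\ upto z s, ctx s T st & temp_ok s T n] ->
  [/\ upto z s', ctx s' T st & temp_ok s' T n].
  move=> eqs str [up [c3 c6 c12 cst] [s8 vals bnd]]; split.
  - move=> z' z'n; have [h0 h1 h2] := up z' z'n.
    by split; rewrite ?eqs ?adr_reg //; apply: slot_ok_eq h2 => d _ _; rewrite eqs // adr_reg.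
  - by split; rewrite ?eqs // str.
  - split; first by rewrite eqs.
      by move=> i i_n yx; rewrite eqs ?adr_reg // vals.
    by move=> c c_lt; rewrite eqs ?adr_reg // bnd.
apply: (@wp_for _ _ _ _ _ (fun z s => [/\ upto z s, ctx s T st & temp_ok s T n]) ns);
  rewrite ?reg_lt //.
- by move=> z s _ [_ [c3 _ _ _] _]; rewrite evalE c3.
- apply: (keep s0 _ 0) => //; first by move=> a a4; rewrite get_write (negbTE a4).
- move=> z s zn s4 [up cx tmp]; have [c3 c6 c12 cst] := cx.
  have [seed wid okz] := up z zn; apply: wp_if.
  have -> : holds w s (Eq (Defs.Sub (reg 6)
               (Mul (Div (reg 6) (width_at (reg 4))) (width_at (reg 4))))
            (Cell (adrE (reg 4) (Lit 0)))) = (T %% W z == sg z).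
    rewrite [LHS]/(eval w s _ == eval w s (Cell (adrE (reg 4) (Lit 0)))).
    rewrite !evalE s4 c6 !int_inl /= wid seed !int_inl.
    by rewrite {1}(divn_eq T (W z)) addKn.
  have done_ s' : (forall z', z' < ns -> z' != z ->
         forall d, d < k + 3 -> get s' (adr k z' d) = get s (adr k z' d)) ->
       get s' (adr k z 0) = inl (sg z) -> get s' (adr k z 1) = inl (W z) ->
       slot_ok s' z (holding z T.+1) -> upto z.+1 s'.
    move=> eqs h0 h1 h2 z' z'n; rewrite ltnS leq_eqVlt.
    case: (eqVneq z' z) => [->//|z'z] /=; have [g0 g1 g2] := up z' z'n.
    split; rewrite ?eqs //; try lia.
    by apply: slot_ok_eq g2 => d _ dk; apply: eqs.
  case hit: (T %% W z == sg z); last first.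
    apply: wp_skip; split=> //; apply: (keep s _ z.+1) => //.
      by move=> a a4; rewrite get_write (negbTE a4).
    split=> //; apply: done_ => //.
    by move: okz; rewrite ltnn /holding /= hit.
  apply: (wp_copy_slot Tn zn s4 cx tmp) => s1 str g okz1.
  have gr r : r < 16 -> r != 9 -> get s1 r = get s r.
    by move=> r16 r9; apply: g => // d _ _; rewrite reg_adr.
  have gz z' d : z' != z -> d < k + 3 -> get s1 (adr k z' d) = get s (adr k z' d).
    move=> z'z dk; apply: g; first by rewrite adr_reg.
    by move=> d' d2 dk'; rewrite adr_eq // (negbTE z'z).
  split; first by rewrite gr.
  apply: (keep s1 _ z.+1) => //; first by move=> a a4; rewrite get_write (negbTE a4).
  split; first apply: done_.
  + by move=> z' _ z'z d dk; apply: gz.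
  + by rewrite g ?adr_reg // => d d2 dk; rewrite adr_eq //; lia.
  + by rewrite g ?adr_reg // => d d2 dk; rewrite adr_eq //; lia.
  + by rewrite /holding /= hit.
  + by split; rewrite ?gr.
  have [s8 vals bnd] := tmp; have nz : ns != z by rewrite gtn_eqF.
  split; first by rewrite gr.
    move=> i i_n yx; rewrite gz ?vals //.
    by rewrite addnC ltn_add2r -yx occ_lt.
  move=> c c_lt; rewrite gz ?bnd //.
  by rewrite addnC ltn_add2r; apply: leq_trans c_lt (occ_leq_k _ _).
- move=> s _ [up [c3 c6 c12 cst] _]; apply: post => // z zn.
  by have := up z zn; rewrite zn.
Qed.

Lemma wp_readx r Q s a st : r < sp -> stream s = a :: st ->
  (forall s', stream s' = st ->
    (forall b, get s' b = if b == r then inr a else get s b) -> Q s') ->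
  wp w sp wd (ReadX (Lit r)) Q s.
Proof.
move=> r_sp str post i; exists 1.
exists (write (State (memory s) (peak s) st) r (inr a)); split.
- by move=> f; rewrite add1n /= str.
- by apply: within_write.
- by apply: post => // b; rewrite get_write.
Qed.

Lemma wp_stream_loop s0 Q : slots_ok s0 0 -> get s0 3 = inl ns -> stream s0 = x ->
  (forall s, slots_ok s n -> get s 3 = inl ns -> Q s) ->
  wp w sp wd stream_loop Q s0.
Proof.
move=> ok0 c30 str0 post.
apply: (@wp_for _ _ _ _ _
  (fun T s => [/\ slots_ok s T, get s 3 = inl ns & stream s = drop T x]) n);
  rewrite ?reg_lt //.
- split; rewrite ?get_write ?drop0 //.
  by apply: slots_ok_eq ok0 => z d _ _; rewrite get_write adr_reg.
- move=> T s Tn s6 [ok c3 str].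
  have strE : stream s = xs T :: drop T.+1 x by rewrite str (drop_nth x0) ?sx.
  apply/wp_seq/(wp_readx _ strE); first exact: reg_lt.
  move=> s1 str1 g1; apply/wp_seq/(@wp_fill_column _ _ T (drop T.+1 x)) => //.
  + by apply: slots_ok_eq ok => z d _ _; rewrite g1 adr_reg.
  + by split; rewrite ?g1.
  move=> s2 ok2 cx2 tmp2; apply: (wp_copy_column Tn ok2 cx2 tmp2).
  move=> s3 ok3 s33 s36 str3; split=> //; split=> //; last by rewrite get_write.
  by apply: slots_ok_eq ok3 => z d _ _; rewrite get_write adr_reg.
- by move=> s _ [ok c3 _]; apply: post.
Qed.

Lemma wp_main s0 : slots_ok s0 0 -> get s0 3 = inl ns -> stream s0 = x ->
  wp w sp wd (Seq stream_loop finish) (fun s => output s = n - est n n) s0.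
Proof.
move=> ok0 c30 str0; apply/wp_seq/wp_stream_loop => // s ok c3.
apply/wp_seq/(@wp_set _ _ _ _ _ _ _ (inl n)); rewrite ?reg_lt //.
apply/wp_seq/(@wp_query _ _ n n); rewrite ?get_write //.
  by apply: slots_ok_eq ok => z d _ _; rewrite get_write adr_reg.
move=> s1 _ s11; apply: (@wp_set _ _ _ _ _ _ _ (inl (n - est n n))).
- by rewrite reg_lt.
- by rewrite !evalE s11.
- by apply: leq_trans (leq_subr _ _) n_wd.
- by rewrite /output -/(get _ 0) get_write.
Qed.

End Program.

(** * Choice of the parameters and assembly of the program *)

Definition choose_m : cmd :=
  Seq (Assign (Lit 1) (Lit 0))
      (While (And (Not (LeDelta (Lit 1) (reg 1))) (Le (reg 1) ParN)) (incr 1)).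

Definition choose_lev : cmd :=
  Seq (Assign (Lit 2) (Lit 1))
  (Seq (Assign (Lit 5) (Lit 1))
       (While (Not (Le ParN (reg 5)))
          (Seq (Assign (Lit 5) (Mul (reg 5) (Lit 2))) (incr 2)))).

(** The width doubles from slot to slot and returns to 1 after the first power of 2 that reaches
    [n]. All [lev] scales thus occur equally often, without a logarithm being computed here. *)
Definition set_widths : cmd :=
  Seq (Assign (Lit 3) (Mul (Mul (Mul (Lit 8) (reg 1)) (reg 2)) (reg 2)))
  (Seq (Assign (Lit 5) (Lit 1))
       (for_ 4 (reg 3)
          (Seq (Assign (adrE (reg 4) (Lit 1)) (reg 5))
               (If (Le ParN (reg 5)) (Assign (Lit 5) (Lit 1))
                   (Assign (Lit 5) (Mul (reg 5) (Lit 2))))))).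

Definition prelude : cmd :=
  Seq choose_m (Seq choose_lev (Seq set_widths (Assign (Lit 4) (Lit 0)))).

Definition draw_seeds : cmd :=
  While (Le (Add (reg 4) (Lit 1)) (reg 3))
        (Seq (Draw (adrE (reg 4) (Lit 0)) (width_at (reg 4))) (incr 4)).

(** For delta >= 1 the value [n] is itself a valid answer, and for [n = 1] the required success
    probability 1 - 1/n is 0. In the other branch delta < 1, which later gives m <= 2/delta. *)
Definition program : cmd :=
  If (And (Le (Lit 2) ParN) (Not (LeDelta (Lit 1) (Lit 1))))
     (Seq prelude (Seq draw_seeds (Seq stream_loop finish)))
     (Assign (Lit 0) ParN).

Section Setup.
Variables (R : realType) (S : eqType) (delta : R) (n k : nat) (y : seq S).
Variables (m lev sp wd : nat).
Let w := Input delta n k y.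
Let ns := 8 * m * lev * lev.
(** The cap [n < i] keeps [m] polynomial in [n] for tiny delta; beyond it a loss of at most n/m
    points is no loss. *)
Let fine_enough i := ((1 <= delta * i%:R)%R || (n < i)).
Hypotheses (n_gt1 : 1 < n) (lev_eq : lev = (up_log 2 n).+1).
Hypotheses (m_fine : fine_enough m) (m_min : forall i, fine_enough i -> m <= i).
Hypotheses (sp_ge : adr k ns (k + 3) <= sp).
Hypotheses (ns_wd : ns <= wd) (n2_wd : n.*2 <= wd) (m_wd : m <= wd) (lev_wd : lev <= wd).
Implicit Types s : state S.

Let reg_sp r : r < 16 -> r < sp.
Proof. by move=> r16; apply: leq_trans sp_ge; rewrite /adr; lia. Qed.

Lemma pow_lt i : 2 ^ i < n -> i < up_log 2 n.
Proof.
move=> lt_n; rewrite ltnNge; apply/negP => le_i.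
have := leq_trans (up_logP n (isT : 1 < 2)) (leq_pexp2l (isT : 0 < 2) le_i); lia.
Qed.

Lemma pow_wd i : 2 ^ i < n -> (2 ^ i).*2 <= wd.
Proof. by move=> lt_n; apply: leq_trans n2_wd; rewrite leq_double ltnW. Qed.

Lemma wp_choose_m s0 Q :
  (forall s, same s0 s [:: 1] -> get s 1 = inl m -> Q s) ->
  wp w sp wd choose_m Q s0.
Proof.
move=> post; apply/wp_seq/(@wp_set _ _ _ _ _ _ _ (inl 0)); rewrite ?reg_sp //.
pose I s := same s0 s [:: 1] /\ exists2 i, get s 1 = inl i & i <= m.
have holdsE s i : get s 1 = inl i ->
    holds w s (And (Not (LeDelta (Lit 1) (reg 1))) (Le (reg 1) ParN))
    = ~~ fine_enough i.
  by move=> s1; rewrite /= -/(get s 1) s1 /= negb_or -leqNgt.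
apply: (@wp_while _ _ _ _ _ I (fun s => m - int_of (get s 1))).
- move=> s [sm [i s1 im]]; rewrite (holdsE _ i) // => not_fine.
  have lt_im : i < m.
    rewrite ltn_neqAle im andbT; apply: contra not_fine => /eqP->; exact: m_fine.
  apply: (@wp_set _ _ _ _ _ _ _ (inl i.+1)); rewrite ?reg_sp //.
  + by rewrite !evalE s1 addn1.
  + exact: leq_trans lt_im m_wd.
  split; last by rewrite !get_write s1 /=; lia.
  split; first exact: same_write.
  by exists i.+1; rewrite ?get_write.
- move=> s [sm [i s1 im]]; rewrite (holdsE _ i) // negbK => /m_min mi.
  by apply: post => //; rewrite s1; congr inl; lia.
- by split; [apply: same_write | exists 0; rewrite ?get_write].
Qed.

Lemma wp_choose_lev s0 Q :
  (forall s, same s0 s [:: 2; 5] -> get s 2 = inl lev -> Q s) ->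
  wp w sp wd choose_lev Q s0.
Proof.
move=> post; have wd1 : 1 <= wd by lia.
apply/wp_seq/(@wp_set _ _ _ _ _ _ _ (inl 1)); rewrite ?reg_sp //.
apply/wp_seq/(@wp_set _ _ _ _ _ _ _ (inl 1)); rewrite ?reg_sp //.
pose I s := same s0 s [:: 2; 5] /\ exists i,
  [/\ get s 2 = inl i.+1, get s 5 = inl (2 ^ i) & i <= up_log 2 n].
apply: (@wp_while _ _ _ _ _ I (fun s => lev - int_of (get s 2))).
- move=> s [sm [i [s2 s5 i_le]]] /=; rewrite -/(get s 5) s5 /= -ltnNge => lt_n.
  have lt_i := pow_lt lt_n.
  apply/wp_seq/(@wp_set _ _ _ _ _ _ _ (inl (2 ^ i.+1))); rewrite ?reg_sp //.
  + by rewrite !evalE s5 expnSr.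
  + by rewrite int_inl expnS mul2n pow_wd.
  apply: (@wp_set _ _ _ _ _ _ _ (inl i.+2)); rewrite ?reg_sp //.
  + by rewrite !evalE get_write /= s2 addn1.
  + by rewrite int_inl; lia.
  split; last by rewrite !get_write s2 /=; lia.
  split; first by do 2 apply: same_write => //.
  by exists i.+1; rewrite !get_write.
- move=> s [sm [i [s2 s5 i_le]]] /=; rewrite -/(get s 5) s5 /= negbK => n_le.
  have := up_log_min (isT : 1 < 2) n_le => le_i.
  by apply: post => //; rewrite s2 lev_eq; congr inl; lia.
- split; first by do 2 apply: same_write => //.
  by exists 0; rewrite !get_write.
Qed.

Lemma wp_set_widths s0 Q : get s0 1 = inl m -> get s0 2 = inl lev ->
  (forall s, stream s = stream s0 -> get s 3 = inl ns ->
     (forall z, z < ns -> get s (adr k z 1) = inl (2 ^ (z %% lev))) ->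
     (forall z, get s (adr k z 2) = get s0 (adr k z 2)) -> Q s) ->
  wp w sp wd set_widths Q s0.
Proof.
move=> s01 s02 post; have wd1 : 1 <= wd by lia.
apply/wp_seq/(@wp_set _ _ _ _ _ _ _ (inl ns)); rewrite ?reg_sp //.
  by rewrite !evalE s01 s02.
apply/wp_seq/(@wp_set _ _ _ _ _ _ _ (inl 1)); rewrite ?reg_sp //.
apply: (@wp_for _ _ _ _ _ (fun z s =>
  [/\ stream s = stream s0, get s 3 = inl ns & get s 5 = inl (2 ^ (z %% lev))] /\
  (forall z', z' < z -> get s (adr k z' 1) = inl (2 ^ (z' %% lev))) /\
  (forall z', get s (adr k z' 2) = get s0 (adr k z' 2))) ns); rewrite ?reg_sp //.
- by move=> z s _ [[_ s3 _] _]; rewrite evalE s3.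
- split; first by rewrite !get_write /= mod0n.
  by split=> // z; rewrite !get_write !adr_reg.
- move=> z s zn s4 [[str s3 s5] [wid sym]].
  have zlev : z %% lev <= up_log 2 n by rewrite -ltnS -lev_eq ltn_mod lev_eq.
  have aE : int_of (eval w s (adrE (reg 4) (Lit 1))) = adr k z 1.
    by rewrite !evalE s4.
  have pow_le : 2 ^ (z %% lev) <= wd.
    (* A width that reaches [n] is 1 or twice a power below [n], hence within the bound 2n. *)
    case: (ltnP (2 ^ (z %% lev)) n) => [|n_le]; first by move/pow_wd; lia.
    case E : (z %% lev) zlev n_le => [|i] // i_le _.
    rewrite expnS mul2n pow_wd // ltnNge; apply/negP => n_le.
    have := up_log_min (isT : 1 < 2) n_le; lia.
  apply/wp_seq/wp_assign; rewrite ?aE ?evalE ?s5 //.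
    by apply: leq_trans sp_ge; apply: adr_lt; rewrite ?(ltnW zn) //; lia.
  apply: wp_if; set s1 := write s _ _.
  have [s14 s15] : get s1 4 = inl z /\ get s1 5 = inl (2 ^ (z %% lev)).
    by rewrite /s1 !get_write !reg_adr.
  have -> : holds w s1 (Le ParN (reg 5)) = (n <= 2 ^ (z %% lev)).
    by rewrite /= -/(get s1 5) s15.
  have next v : v = 2 ^ (z.+1 %% lev) ->
      let s2 := write s1 5 (inl v) in
      get s2 4 = inl z /\ let s3 := write s2 4 (inl z.+1) in
      [/\ stream s3 = stream s0, get s3 3 = inl ns & get s3 5 = inl (2 ^ (z.+1 %% lev))] /\
      (forall z', z' < z.+1 -> get s3 (adr k z' 1) = inl (2 ^ (z' %% lev))) /\
      (forall z', get s3 (adr k z' 2) = get s0 (adr k z' 2)).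
    move=> -> /=; split; first by rewrite get_write.
    split; first by split; rewrite 2?get_write /= /s1 ?get_write ?reg_adr.
    split=> z' => [|]; last first.
      by rewrite /s1 !get_write (adr_reg _ _ _ (isT : 4 < 16)) (adr_reg _ _ _ (isT : 5 < 16)) // adr_eq ?andbF ?sym //; lia.
    rewrite ltnS leq_eqVlt /s1 !get_write (adr_reg _ _ _ (isT : 4 < 16)) (adr_reg _ _ _ (isT : 5 < 16)) // => z'z.
    rewrite adr_eq; [|lia..]; rewrite eqxx andbT.
    by case: eqP z'z => [->//|_] /= /wid.
  have modS : z.+1 %% lev = if (z %% lev).+1 == lev then 0 else (z %% lev).+1.
    rewrite -addn1 -modnDml addn1; case: eqP => [->|]; first exact: modnn.
    by move=> ne; rewrite modn_small //; lia.
  case: ifP => n_le.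
    apply: (@wp_set _ _ _ _ _ _ _ (inl 1)); rewrite ?reg_sp //.
    apply: next; rewrite modS ifT //; apply/eqP.
    have := up_log_min (isT : 1 < 2) n_le; lia.
  move/negbT: n_le; rewrite -ltnNge => lt_n.
  have lt_i := pow_lt lt_n.
  apply: (@wp_set _ _ _ _ _ _ _ (inl (2 ^ (z %% lev).+1))); rewrite ?reg_sp //.
  + by rewrite !evalE s15 expnSr.
  + by rewrite int_inl expnS mul2n pow_wd.
  by apply: next; rewrite modS ifF //; apply/eqP; lia.
- by move=> s _ [[str s3 _] [wid sym]]; apply: post.
Qed.

Lemma wp_prelude (x : seq S) :
  wp w sp wd prelude
    (fun s => [/\ stream s = x, get s 3 = inl ns, get s 4 = inl 0,
       forall z, z < ns -> get s (adr k z 1) = inl (2 ^ (z %% lev))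
     & forall z, get s (adr k z 2) = inl 0]) (init x).
Proof.
apply/wp_seq/wp_choose_m => s1 sm1 s1m.
apply/wp_seq/wp_choose_lev => s2 sm2 s2l.
apply/wp_seq/wp_set_widths => //; first by rewrite (proj2 sm2).
move=> s3 str s33 wid sym.
apply: (@wp_set _ _ _ _ _ _ _ (inl 0)); rewrite ?reg_sp //.
split; rewrite ?get_write //=.
- by rewrite str (proj1 sm2) (proj1 sm1).
- by move=> z zn; rewrite get_write adr_reg // wid.
- move=> z; rewrite get_write adr_reg // sym.
  by rewrite (@same_adr _ s1 _ [:: 2; 5]) // (@same_adr _ (init x) _ [:: 1]) //.
Qed.

End Setup.

(** * Drawing the seeds *)

Section Draws.
Variables (R : realType) (S : eqType) (delta : R) (n k : nat) (y : seq S).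
Let w := Input delta n k y.
Implicit Types s : state S.

Definition draw_step s (a : nat) : state S :=
  let z := int_of (get s 4) in write (write s (adr k z 0) (inl a)) 4 (inl z.+1).

Lemma draw_step_next s a z : get s 4 = inl z ->
  get (draw_step s a) 4 = inl z.+1.
Proof. by move=> s4; rewrite /draw_step s4 get_write. Qed.

(** Random choices lie outside [wp], so the loop is identified, as a tree, with independent draws
    followed by deterministic writes. Each turn costs one unit of fuel; the 3 covers the nesting of
    [While], [Seq] and a basic command. *)
Lemma exec_draw_seeds ws s z : get s 4 = inl z -> get s 3 = inl (z + size ws) ->
  (forall i, i < size ws -> get s (adr k (z + i) 1) = inl (nth 0 ws i)) ->
  forall f, exec w (size ws + 3 + f) draw_seeds s
    = bind (draw_all ws) (fun l => Ret (Some (foldl draw_step s l))).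
Proof.
elim: ws s z => [|v ws IH] s z s4 s3 wid f.
  rewrite /= /draw_seeds add0n addSn /= -/(get s 4) -/(get s 3) s4 s3 /=.
  by rewrite addn0 addn1 ltnn.
have step g : exec w g.+3 draw_seeds s = Choose v.-1 (fun a =>
    exec w g.+2 draw_seeds (draw_step s a)).
  have body : exec w g.+2
      (Seq (Draw (adrE (reg 4) (Lit 0)) (width_at (reg 4))) (incr 4)) s
    = Choose v.-1 (fun a => Ret (Some (draw_step s a))).
    rewrite /= -/(get s 4) s4 /= -/(adr k z 1) -/(get s (adr k z 1)).
    rewrite -[z in adr k z 1]addn0 wid //=; congr Choose.
    apply: functional_extensionality => a; rewrite /draw_step s4 -/(adr k z 0) /=.
    by rewrite -/(get (write s (adr k z 0) (inl a)) 4) get_write reg_adr // s4 /= addn1.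
  have loop : holds w s (Le (Add (reg 4) (Lit 1)) (reg 3)).
    by rewrite /= -/(get s 4) -/(get s 3) s4 s3 /= addn1 addnS ltnS leq_addr.
  by rewrite /draw_seeds exec_while loop body.
have -> : size (v :: ws) + 3 + f = (size ws + f).+1.+3 by rewrite /=; lia.
rewrite step [draw_all _]/= [bind _ _]/=; congr Choose; apply: functional_extensionality => a.
rewrite bind_bind.
have -> : (size ws + f).+3 = size ws + 3 + f by lia.
rewrite (IH _ z.+1) //.
- exact: draw_step_next.
- by rewrite /draw_step 2!get_write [3 == 4]/= reg_adr // s3 /= addSnnS.
- move=> i i_ws; rewrite /draw_step !get_write adr_reg // s4 /=.
  by rewrite adr_eq ?andbF /= -?(wid i.+1) ?addnS //; lia.
Qed.

Lemma draw_step_foldl N sp wd l s z : adr k N (k + 3) <= sp -> N <= wd ->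
  get s 4 = inl z -> z + size l <= N -> all (leq^~ wd) l -> within sp wd s ->
  let s' := foldl draw_step s l in
  [/\ within sp wd s', stream s' = stream s,
      forall i, i < size l -> get s' (adr k (z + i) 0) = inl (nth 0 l i)
    & forall a, a != 4 -> (forall i, i < size l -> a != adr k (z + i) 0) ->
        get s' a = get s a].
Proof.
move=> sp_ge N_wd; have sp4 : 4 < sp by apply: leq_trans sp_ge; rewrite /adr; lia.
elim: l s z => [//|a l IH] s z s4 /= zl /andP[a_wd l_wd] ws.
have s1w : within sp wd (draw_step s a).
  rewrite /draw_step s4 /=; apply: within_write; [|exact: sp4|by rewrite /=; lia].
  by apply: within_write => //; apply: leq_trans sp_ge; apply: adr_lt; lia.
have zl' : z.+1 + size l <= N by lia.
have [st' str seeds other] := IH _ z.+1 (draw_step_next a s4) zl' l_wd s1w.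
split=> //.
- case=> [_|i i_l] /=; last by rewrite -addSnnS seeds.
  rewrite addn0 other ?adr_reg // => [|i _].
    by rewrite /draw_step s4 !get_write adr_reg // eqxx.
  by rewrite adr_eq ?andbT; lia.
- move=> b b4 bz; rewrite other // => [|i i_l]; last by rewrite addSnnS bz.
  have := bz 0 isT; rewrite addn0 /draw_step s4 !get_write (negbTE b4) /=.
  by move/negbTE->.
Qed.
End Draws.

Local Open Scope ring_scope.

(** * Error probability *)

Lemma all2_nthPn (s l : seq nat) (B : nat -> pred nat) :
  size l = size s -> ~~ all2 B s l ->
  exists2 z, (z < size s)%N & ~~ B (nth 0%N s z) (nth 0%N l z).
Proof.
elim: s l => [|w s IH] [|a l] //= [] /IH {}IH; rewrite negb_and.
case/orP=> [Bwa|/IH [z zs Bz]]; first by exists 0%N.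
by exists z.+1.
Qed.

(** Points of a window of length [w] have distinct residues modulo [w], so [e - b] of the [w] seeds
    hit. *)
Lemma window_misses (f : nat -> nat) lo b e w : (b <= e)%N ->
  (forall i i', i < i' -> i' < e -> f i < f i')%N ->
  (forall i, b <= i < e -> lo <= f i < lo + w)%N ->
  (0 < w)%N ->
  ((\sum_(a < w) all (fun i => f i %% w != a) (iota b (e - b))) + (e - b) <= w)%N.
Proof.
move=> be f_mono f_win w0; pose s := [seq (f i %% w)%N | i <- iota b (e - b)].
have us : uniq s.
  rewrite map_inj_in_uniq ?iota_uniq // => i i'.
  rewrite !mem_iota !subnKC // => bi bi' /eqP fii'; apply/eqP.
  have := f_win _ bi; have := f_win _ bi'; move: bi bi' fii'.
  wlog ii' : i i' / (i <= i')%N => [th|].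
    case: (leqP i i') => [/th//|/ltnW i'i] *; rewrite eq_sym; apply: th => //.
    by rewrite eq_sym.
  case: (ltngtP i i') ii' => // ii' _ bi bi' fii' wi' wi.
  have lt_f : (f i < f i')%N by apply: f_mono => //; lia.
  move: fii'; rewrite eq_sym eqn_mod_dvd ?(ltnW lt_f) // => /dvdn_leq; lia.
have ss : {subset s <= filter [in s] (iota 0 w)}.
  move=> a sa; rewrite mem_filter sa mem_iota /= add0n.
  by case/mapP: sa => i _ ->; rewrite ltn_mod.
have := uniq_leq_size us ss; rewrite size_filter size_map size_iota => le_c.
rewrite (eq_bigr (fun a : 'I_w => (predC [in s] a : nat))); last first.
  move=> a _; congr (nat_of_bool _); rewrite /= -has_pred1 -all_predC all_map.
  by apply: eq_all => i /=.
rewrite -(big_mkord xpredT (fun a => predC [in s] a : nat)).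
have -> : (\sum_(0 <= a < w) [predC s] a)%N = count [predC s] (iota 0 w).
  by rewrite -sumn_count sumnE big_map /index_iota subn0.
rewrite -[leqRHS](size_iota 0 w) -(count_predC [in s]) addnC leq_add2r.
exact: le_c.
Qed.

Lemma bernoulli_half (R : realType) (M : nat) : (0 < M)%N ->
  (1 - M%:R^-1) ^+ M <= 2^-1 :> R.
Proof.
move=> M0; set t := M%:R^-1 : R.
have t0 : 0 <= t by rewrite invr_ge0.
have t1 : t <= 1 by rewrite invf_le1 ?ler1n ?ltr0n.
(* Induction via (1 - t)(1 + (j+1)t) <= 1 + jt; at [j = M] the second factor is 2. *)
have H j : (1 - t) ^+ j * (1 + j%:R * t) <= 1.
  elim: j => [|j IH]; first by rewrite expr0 mul0r addr0 mulr1.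
  rewrite exprSr -mulrA; apply: le_trans IH.
  rewrite ler_wpM2l ?exprn_ge0 ?subr_ge0 // -natr1.
  have := ler0n R j; nra.
have := H M; rewrite divff ?pnatr_eq0 -?lt0n // => HM.
lra.
Qed.

Lemma count_modn Q L i : (i < L)%N ->
  count (fun z => z %% L == i)%N (iota 0 (Q * L)) = Q.
Proof.
move=> iL; elim: Q => [|Q IH]; first by rewrite mul0n.
rewrite mulSnr iotaD count_cat IH add0n -[X in iota X L]addn0 iotaDl count_map.
rewrite -addn1; congr addn.
rewrite (eq_in_count (a2 := pred1 i)); last first.
  move=> z; rewrite mem_iota /= add0n => zL.
  by rewrite modnMDl modn_small.
by rewrite count_uniq_mem ?iota_uniq // mem_iota /= add0n iL.
Qed.

Section GoodSeeds.
Variables (R : realType) (n m lev h : nat) (f : nat -> nat).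
Hypotheses (n_gt1 : (1 < n)%N) (m_gt0 : (0 < m)%N) (lev_gt0 : (0 < lev)%N).
Hypothesis n_le : (n <= 2 ^ lev.-1)%N.
Hypothesis hn : (h <= n)%N.
Hypothesis f_mono : forall i i', (i < i' -> i' <= h -> f i < f i')%N.
Hypothesis fh : f h = n.

Definition widths := [seq (2 ^ (z %% lev))%N | z <- iota 0 (8 * m * lev * lev)].

Definition scale (b e : nat) : nat := 2 ^ up_log 2 (f e - gap_start f b).

(** Slots of other widths miss by convention. Missing one window is then a conjunction over all
    slots, to which [prob_draw_all] applies, with factors at most 1 for the other widths. *)
Definition misses (p : nat * nat) (w a : nat) : bool :=
  (w == scale p.1 p.2) ==>
  all (fun i => f i %% w != a)%N (iota p.1 (p.2 - p.1)).

Definition bad (p : nat * nat) (l : seq nat) : bool :=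
  [&& p.1 < p.2, p.2 <= h, f p.2 - gap_start f p.1 < m * (p.2 - p.1)
    & all2 (misses p) widths l]%N.

Definition good_seeds (l : seq nat) : bool :=
  ~~ has (fun p => bad p l) [seq (b, e) | b <- iota 0 n, e <- iota 1 n].

Lemma lo_lt b e : (b < e -> e <= h -> gap_start f b < f e)%N.
Proof.
case: b => [|b] be eh /=; first by apply: leq_trans (f_mono be eh).
have bb : (b < b.+1)%N by [].
by apply: leq_ltn_trans (f_mono be eh); apply: f_mono => //; apply: ltnW (leq_trans be eh).
Qed.

Lemma lo_le b i : (b <= i -> i <= h -> gap_start f b <= f i)%N.
Proof. by case: b => [//|b] bi ih; apply: f_mono. Qed.

Lemma scale_bounds b e : (b < e -> e <= h ->
  let l := f e - gap_start f b in l <= scale b e < l.*2)%N.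
Proof.
move=> be eh /=; have := lo_lt be eh; rewrite -subn_gt0 /scale.
move: (f e - gap_start f b)%N => l l0; rewrite up_logP //=.
case: (ltnP 1 l) => l1; last by have -> : l = 1%N by lia.
have /andP[+ _] := @up_log_bounds 2 l isT l1.
have : (0 < up_log 2 l)%N by rewrite up_log_gt0.
by case: (up_log 2 l) => //= k _; rewrite expnS mul2n ltn_double.
Qed.

(** If not all slots miss, some slot of width [scale b e] has the residue of a chain point in the
    window as its seed. Its width is at least the window length, so by [held_window] that point is
    still held at time [f e]. *)
Lemma good_seeds_dense l : size l = size widths -> good_seeds l ->
  hits_dense_windows (size widths) (nth 0%N widths) (nth 0%N l) m h f.
Proof.
move=> sz /hasPn good b e be eh dense.
have /good : (b, e) \in [seq (b, e) | b <- iota 0 n, e <- iota 1 n].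
  by rewrite allpairs_f // mem_iota; lia.
rewrite /bad /= be eh dense /= => /(all2_nthPn sz) [z zs].
rewrite negb_imply => /andP[/eqP /= wz /allPn /= [i]].
rewrite mem_iota subnKC ?(ltnW be) // => /andP[bi ie] /negPn /eqP fi.
exists z, i; split=> //; first by rewrite bi.
apply: held_window => //; first exact: f_mono.
have /andP[+ _] := scale_bounds be eh; rewrite wz.
have := lo_le bi (ltnW (leq_trans ie eh)); lia.
Qed.

Lemma count_scale b e : (b < e -> e <= h ->
  count_mem (scale b e) widths = 8 * m * lev)%N.
Proof.
move=> be eh; rewrite /widths count_map.
rewrite -[RHS](@count_modn (8 * m * lev) lev (up_log 2 (f e - gap_start f b))).
  apply: eq_count => z /=; rewrite /scale eqn_exp2l //.
apply: (@leq_ltn_trans lev.-1); last by rewrite prednK.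
apply: up_log_min => //; apply: leq_trans n_le.
rewrite -fh; apply: leq_trans (leq_subr _ _) _.
case: (ltngtP e h) eh => // [eh _|-> //]; exact: ltnW (f_mono eh (leqnn h)).
Qed.

(** The width is less than twice the window length and the window is dense, so w < 2m(e - b); by
    [window_misses] a fraction of at least 1/(2m) of the seeds hits. *)
Lemma miss_prob b e :
  (b < e)%N -> (e <= h)%N -> (f e - gap_start f b < m * (e - b))%N ->
  let w := scale b e in
  (\sum_(a < w.-1.+1) (misses (b, e) w a)%:R) / w.-1.+1%:R
    <= 1 - (m * 2)%:R^-1 :> R.
Proof.
move=> be eh dense /=; set w := scale b e.
have w0 : (0 < w)%N by rewrite expn_gt0.
have /andP[lw wl] := scale_bounds be eh; rewrite -/w in lw wl.
have f_mono_e i i' : (i < i' -> i' < e -> f i < f i')%N.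
  by move=> ii' i'e; apply: f_mono => //; apply: ltnW (leq_trans i'e eh).
have f_win i : (b <= i < e -> gap_start f b <= f i < gap_start f b + w)%N.
  case/andP=> bi ie.
  by have := lo_le bi (ltnW (leq_trans ie eh)); have := f_mono ie eh; lia.
have missed := window_misses (ltnW be) f_mono_e f_win w0.
rewrite prednK // /misses eqxx /=.
rewrite ler_pdivrMr ?ltr0n // -natr_sum mulrBl mul1r lerBrDr.
apply: (@le_trans _ _ (w - (e - b) + (e - b))%:R); last by rewrite ler_nat; lia.
rewrite natrD lerD //.
  by rewrite ler_nat; move: missed; set X := (\sum_(a < w) _)%N; clearbody X; lia.
rewrite mulrC ler_pdivrMr ?ltr0n ?muln_gt0 ?m_gt0 // -natrM ler_nat; lia.
Qed.

Lemma bad_prob p : prob R (bad p) (draw_all widths) <= (2 ^ (4 * lev))%:R^-1.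
Proof.
case: p => b e; rewrite /bad /=.
have z0 : 0 <= (2 ^ (4 * lev))%:R^-1 :> R by rewrite invr_ge0.
case be: (b < e)%N; last by rewrite prob_pred0.
case eh: (e <= h)%N; last by rewrite prob_pred0.
case dense: (_ < m * _)%N; last by rewrite prob_pred0.
set q := 1 - (m * 2)%:R^-1 : R.
have m2 : (0 < m * 2)%N by rewrite muln_gt0 m_gt0.
have q0 : 0 <= q.
  by rewrite subr_ge0 invf_le1 ?ler1n ?ltr0n.
apply: (@le_trans _ _ (q ^+ count_mem (scale b e) widths)); last first.
  rewrite count_scale //.
  (* Every block of [2m] slots at least halves the probability, and there are [4 lev] blocks. *)
  have -> : (8 * m * lev = (m * 2) * (4 * lev))%N by lia.
  rewrite exprM natrX -exprVn.
  apply: lerXn2r; rewrite ?nnegrE ?exprn_ge0 ?invr_ge0 //.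
  exact: bernoulli_half.
have -> : prob R [eta all2 (misses (b, e)) widths] (draw_all widths)
  = prob R (all2 (misses (b, e)) widths) (draw_all widths) by [].
rewrite prob_draw_all; elim: widths => [|w ws IH]; first by rewrite big_nil.
rewrite big_cons /= exprD; apply: ler_pM => //.
- by apply: divr_ge0 => //; apply: sumr_ge0.
- by apply: prodr_ge0 => w' _; apply: divr_ge0 => //; apply: sumr_ge0.
case: eqP => [->|_]; first exact: miss_prob.
rewrite expr0 ler_pdivrMr ?ltr0n // mul1r -natr_sum ler_nat.
rewrite -[leqRHS]card_ord -sum1_card.
by apply: leq_sum => a _; apply: leq_b1.
Qed.

Lemma good_seeds_prob : 1 - n%:R^-1 <= prob R good_seeds (draw_all widths).
Proof.
rewrite /good_seeds prob_predC lerD2l lerN2.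
apply: le_trans (prob_union _ _ _ _) _.
apply: le_trans (ler_sum _ (fun p _ => bad_prob p)) _.
rewrite big_const_seq count_predT size_allpairs !size_iota iter_addr_0.
rewrite -[leLHS]mulr_natl ler_pdivrMr ?ltr0n ?expn_gt0 //.
rewrite [leRHS]mulrC ler_pdivlMr ?ltr0n; last by lia.
rewrite -natrM ler_nat.
(* The union bound leaves n^3 <= 2^(4 lev) to prove, and already n <= 2^(lev - 1). *)
have -> : (2 ^ (4 * lev) = (2 ^ lev.-1 * 2) ^ 4)%N.
  by rewrite -expnSr prednK // -expnM mulnC.
apply: (@leq_trans (n ^ 4)); last by rewrite leq_exp2r //; lia.
have -> : (n * n * n = n ^ 3)%N by rewrite !expnS muln1 mulnA.
by rewrite leq_exp2l.
Qed.

End GoodSeeds.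

(** * Correctness and space *)

Section Run.
Variables (R : realType) (S : eqType) (x0 : S) (delta : R) (n k : nat).
Variables (x y : n.-tuple S) (m lev sp wd : nat).
Let w := Input delta n k y.
Let ws := widths m lev.
Let ns := (8 * m * lev * lev)%N.
Let fine_enough i := (1 <= delta * i%:R) || (n < i)%N.
Hypothesis delta_gt0 : 0 < delta.
Hypotheses (n_gt1 : (1 < n)%N) (lev_eq : lev = (up_log 2 n).+1).
Hypotheses (m_fine : fine_enough m) (m_min : forall i, fine_enough i -> (m <= i)%N).
Hypothesis m_gt0 : (0 < m)%N.
Hypothesis y_mult : forall a, (count_mem a y <= k)%N.
Hypotheses (sp_ge : (adr k ns (k + 3) <= sp)%N) (ns_wd : (ns <= wd)%N).
Hypotheses (n2_wd : (n.*2 <= wd)%N) (m_wd : (m <= wd)%N) (lev_wd : (lev <= wd)%N).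

Let est (l : seq nat) := estimate x0 x y ns (nth 0%N ws) (nth 0%N l) n n.

Lemma size_ws : size ws = ns.
Proof. by rewrite size_map size_iota. Qed.

Lemma nth_ws z : (z < ns)%N -> nth 0%N ws z = (2 ^ (z %% lev))%N.
Proof. by move=> zn; rewrite (nth_map 0%N) ?size_iota // nth_iota. Qed.

Lemma n_le_pow : (n <= 2 ^ lev.-1)%N.
Proof. by rewrite lev_eq up_logP. Qed.

Lemma est_le_LCS l : (est l <= LCS x y)%N.
Proof.
have [||u [ux uy su]] := @estimate_sound S x0 x y ns (nth 0%N ws) (nth 0%N l) n n.
- by rewrite size_tuple.
- by rewrite size_tuple.
rewrite /est -su; move: ux uy; rewrite !take_oversize ?size_tuple //.
exact: subseq_leq_LCS.
Qed.

Lemma LCS_le_n : (LCS x y <= n)%N.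
Proof.
have [u [ux _ <-]] := LCS_witness x y.
by rewrite -[leqRHS](size_tuple x) size_subseq.
Qed.

Lemma estimate_approx l :
  ((LCS x y - est l) * m <= n)%N -> additive_approx delta x y (n - est l).
Proof.
move=> loss; have le1 := est_le_LCS l; have le2 := LCS_le_n.
rewrite /additive_approx /E ler_nat; apply/andP; split; first by lia.
have -> : (n - est l = (n - LCS x y) + (LCS x y - est l))%N by lia.
rewrite natrD lerD2l; move: (LCS x y - est l)%N loss => d loss.
case/orP: m_fine => [dm|n_m]; last first.
  have -> : d = 0%N by nia.
  by rewrite mulr_ge0 // ltW.
have n0 : 0 <= n%:R :> R by [].
have d0 : 0 <= d%:R :> R by [].
have : (d * m)%:R <= n%:R :> R by rewrite ler_nat.
rewrite natrM; have m0 : 0 < m%:R :> R by rewrite ltr0n.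
move=> le_n; rewrite -(ler_pM2r m0); apply: le_trans le_n _.
by rewrite mulrAC ler_peMl.
Qed.

(** The chain comes from [x] and [y] alone and is chosen before the seeds, so the probability bound
    for a fixed [f] applies. *)
Lemma good_seeds_exist : exists2 good : pred (seq nat),
  1 - n%:R^-1 <= prob R good (draw_all ws) &
  forall l, size l = size ws -> good l -> ((LCS x y - est l) * m <= n)%N.
Proof.
have [f [g [f_mono g_mono fg fh gh]]] := LCS_chain x0 (size_tuple x) (size_tuple y).
have lev0 : (0 < lev)%N by rewrite lev_eq.
exists (good_seeds n m lev (LCS x y) f).
  exact: (good_seeds_prob R n_gt1 m_gt0 lev0 n_le_pow LCS_le_n f_mono fh).
move=> l sz good.
have dense : hits_dense_windows ns (nth 0%N ws) (nth 0%N l) m (LCS x y) f.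
  rewrite -size_ws; exact: (good_seeds_dense n_gt1 m_gt0 lev0 n_le_pow LCS_le_n f_mono fh sz good).
have := chain_loss f_mono g_mono fg dense (leqnn _).
by rewrite fh gh.
Qed.

Lemma run_spec : exists fuel, let runs :=
  exec w fuel (Seq prelude (Seq draw_seeds (Seq stream_loop finish))) (init x) in
  always (halts_within sp wd) runs /\
  1 - n%:R^-1 <= prob R (outcome_in (additive_approx delta x y)) runs.
Proof.
have within0 : within sp wd (init x) by [].
have n_wd : (n <= wd)%N by lia.
have [F1 [s1 [exec1 w1 [str1 s13 s14 wid1 sym1]]]] :=
  @wp_prelude R S delta n k y m lev sp wd n_gt1 lev_eq m_fine m_min sp_ge
    ns_wd n2_wd m_wd lev_wd x within0.
pose final l := foldl (@draw_step S k) s1 l.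
have exec2 f : exec w (ns + 3 + f) draw_seeds s1
    = bind (draw_all ws) (fun l => Ret (Some (final l))).
  rewrite -size_ws; apply: (@exec_draw_seeds R S delta n k y ws s1 0) => //.
    by rewrite add0n size_ws.
  by move=> i; rewrite size_ws => i_ns; rewrite nth_ws // wid1.
have ws_pos : all (ltn 0) ws by apply/allP => v /mapP[z _ ->]; rewrite /= expn_gt0.
have ws_wd : all (leq^~ wd) ws.
  apply/allP => v /mapP[z _ ->]; apply: leq_trans n2_wd.
  have /andP[lt_n _] := up_log_bounds (isT : (1 < 2)%N) n_gt1.
  have L0 : (0 < up_log 2 n)%N by rewrite up_log_gt0.
  apply: (@leq_trans (2 ^ up_log 2 n)).
    by rewrite leq_exp2l // -ltnS -lev_eq ltn_mod lev_eq.
  by rewrite -(prednK L0) expnS mul2n leq_double ltnW.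
have drawn := always_draw_all ws_pos.
pose main := Seq stream_loop finish.
have mainP l : all2 (fun v a => a < v)%N ws l -> exists F, forall f, (F <= f)%N ->
    exists s', [/\ exec w f main (final l) = Ret (Some s'), within sp wd s'
                 & output s' = (n - est l)%N].
  move=> lP; have [sz_l l_lt] : size l = ns /\ forall z, (z < ns)%N ->
      (nth 0%N l z < nth 0%N ws z)%N.
    rewrite -size_ws; elim: (ws) (l) lP => [|v vs IH] [|a l'] //= /andP[av /IH[-> lt]].
    by split=> // -[].
  have l_wd : all (leq^~ wd) l.
    apply/(all_nthP 0%N) => z; rewrite sz_l => zn.
    apply: ltnW; apply: leq_trans (l_lt z zn) _.
    by apply: (allP ws_wd); rewrite mem_nth // size_ws.
  have zl : (0 + size l <= ns)%N by rewrite sz_l.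
  have [w2 str2 seeds other] :=
    draw_step_foldl sp_ge ns_wd s14 zl l_wd w1.
  rewrite -/(final l) in w2 str2 seeds other.
  have slots0 : slots_ok x0 n k x y ns (nth 0%N ws) (nth 0%N l) (final l) 0.
    move=> z zn; split.
    - by have := seeds z; rewrite add0n sz_l; apply.
    - rewrite other ?adr_reg // => [|i _]; first by rewrite nth_ws // wid1.
      by rewrite adr_eq ?andbF //; lia.
    - rewrite /slot_ok /= other ?adr_reg // => i _.
      by rewrite adr_eq ?andbF //; lia.
  have s3 : get (final l) 3 = inl ns.
    by rewrite other // => i _; rewrite reg_adr.
  have str : stream (final l) = x by rewrite str2.
  have [F [s' [e i o]]] := @wp_main R S x0 delta n k x y ns (nth 0%N ws) (nth 0%N l)
    sp wd (size_tuple x) (size_tuple y) y_mult sp_ge n_wd ns_wd (final l) slots0 s3 str w2.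
  exists F => f /subnKC <-; exists s'; split=> //; exact: e.
have [F2 F2P] := always_uniform (always_imp mainP drawn).
(* The sum dominates the need of each of the three phases; two more units pay for the two enclosing
   [Seq]. [F2] is uniform over all seeds by [always_uniform]. *)
pose fuel := (F1 + (ns + 3) + F2)%N.
exists fuel.+2 => runs.
have runsE : runs = bind (draw_all ws) (fun l => exec w fuel main (final l)).
  rewrite /runs.
  have F1E : fuel.+1 = (F1 + (ns + 3 + F2).+1)%N by rewrite /fuel; lia.
  rewrite exec_seq {1}F1E exec1.
  rewrite -[LHS]/(exec w fuel.+1 (Seq draw_seeds main) s1) exec_seq.
  have fuelE : fuel = (ns + 3 + (F1 + F2))%N by rewrite /fuel; lia.
  by rewrite {1}fuelE exec2 bind_bind.
have fuel_ge : (F2 <= fuel)%N by rewrite leq_addl.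
have mainF := F2P fuel fuel_ge.
rewrite runsE; split.
  by apply: always_bind; apply: always_imp mainF => l [s' [-> [sz pk] _]].
have [good good_prob goodP] := good_seeds_exist.
apply: (le_trans good_prob); apply: prob_bind_ge.
have drawn_size : always (fun l => size l = size ws) (draw_all ws).
  apply: always_imp drawn => l; rewrite all2E => /andP[/eqP->//].
move: drawn_size mainF; elim: (draw_all ws) => [l|j t IH] /= sz mainF; last first.
  by move=> i; apply: IH.
move/(goodP l sz)/estimate_approx; case: mainF => s' [-> _ o] /=.
by rewrite /outcome_in o.
Qed.

End Run.

Lemma up_log2_lt n : (1 < n)%N -> (up_log 2 n < n)%N.
Proof.
move=> n1; have /andP[lt_n _] := up_log_bounds (isT : (1 < 2)%N) n1.
have := ltn_expl (up_log 2 n).-1 (isT : (1 < 2)%N); lia.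
Qed.

Lemma slot_count_le n m lev : (1 < n)%N -> (m <= n.+1)%N -> (lev <= n)%N ->
  (8 * m * lev * lev <= (n + 2) ^ 6)%N.
Proof.
move=> n1 mn ln.
have le3 : (m * lev * lev <= (n + 2) ^ 3)%N.
  by rewrite !expnS expn0 muln1 -mulnA leq_mul ?leq_mul //; lia.
have le8 : (8 <= (n + 2) ^ 3)%N by rewrite (@leq_exp2r 2 (n + 2) 3); lia.
have -> : ((n + 2) ^ 6 = (n + 2) ^ 3 * (n + 2) ^ 3)%N by rewrite -expnD.
have -> : (8 * m * lev * lev = 8 * (m * lev * lev))%N by rewrite -!mulnA.
exact: leq_mul.
Qed.

(** With [L = up_log 2 n], 2^(L-1) < n gives 2^(L+1) < 4n <= n^3. *)
Lemma up_log2_ln (R : realType) n : (1 < n)%N ->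
  (up_log 2 n).+1%:R * ln 2 <= 3 * ln n%:R :> R.
Proof.
move=> n1; have /andP[lt_n _] := up_log_bounds (isT : (1 < 2)%N) n1.
have ln2 : 0 < ln 2 :> R by apply: ln_gt0; rewrite ltr1n.
have n0 : 0 < n%:R :> R by rewrite ltr0n; lia.
rewrite mulr_natl -lnXn ?ltr0n // -[3]/(3%:R) mulr_natl -lnXn //.
rewrite ler_ln ?posrE ?exprn_gt0 // -!natrX ler_nat.
have L0 : (0 < up_log 2 n)%N by rewrite up_log_gt0.
rewrite -[in leqLHS](prednK L0) !expnS expn0 muln1.
move: (2 ^ _)%N lt_n => p lt_n; nia.
Qed.

Lemma space_bound (R : realType) (delta : R) (n k m lev : nat) :
  0 < delta -> delta < 1 -> (1 < n)%N -> (0 < k)%N -> (0 < m)%N ->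
  delta * m.-1%:R < 1 ->
  lev = (up_log 2 n).+1 ->
  (adr k (8 * m * lev * lev) (k + 3))%:R
    <= (16 + 1152 * (ln 2)^-2) * Num.max 1 (delta^-1 * k%:R * ln n%:R ^+ 2).
Proof.
move=> d0 d1 n1 k0 m0 dm levE.
have ln2 : 0 < ln 2 :> R by apply: ln_gt0; rewrite ltr1n.
set X := delta^-1 * k%:R * ln n%:R ^+ 2.
apply: (@le_trans _ _ (16 + 64 * (m * lev ^ 2 * k)%:R)).
  rewrite /adr natrD lerD2l -natrM ler_nat.
  have lev0 : (0 < lev)%N by rewrite levE.
  have : (0 < m * lev ^ 2)%N by rewrite muln_gt0 m0 expn_gt0 lev0.
  have -> : (8 * m * lev * lev = 8 * (m * lev ^ 2))%N by rewrite expnS expn1; lia.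
  move: (m * lev ^ 2)%N => p p0; nia.
(* Minimality of [m] gives delta (m - 1) < 1, and delta < 1. *)
have m_le : m%:R <= 2 * delta^-1.
  rewrite ler_pdivlMr // mulrC -(prednK m0) -natr1 mulrDr mulr1; lra.
have lev_le : lev%:R <= 3 * ln n%:R / ln 2 :> R.
  by rewrite ler_pdivlMr // levE; apply: up_log2_ln.
have lev2_le : lev%:R ^+ 2 <= (3 * ln n%:R / ln 2) ^+ 2 :> R.
  by rewrite ler_pXn2r ?nnegrE //; apply: le_trans lev_le.
(* Here 1152 = 64 * 2 * 9, from the bounds on the cell count, on [m] and on [lev] squared. *)
have XE : 64 * (2 * delta^-1 * (3 * ln n%:R / ln 2) ^+ 2 * k%:R)
  = 1152 * (ln 2)^-2 * X.
  rewrite /X; field; rewrite ?lt0r_neq0 //.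
have prod_le : (m * lev ^ 2 * k)%:R
    <= 2 * delta^-1 * (3 * ln n%:R / ln 2) ^+ 2 * k%:R.
  by rewrite 2!natrM natrX ler_wpM2r // ler_pM // ?sqr_ge0.
rewrite [leRHS]mulrDl; apply: lerD.
  by rewrite ler_peMr // le_max lexx.
apply: (@le_trans _ _ (1152 * (ln 2)^-2 * X)).
  by rewrite -XE ler_wpM2l.
by rewrite ler_wpM2l ?le_max ?lexx ?orbT // mulr_ge0 // invr_ge0 sqr_ge0.
Qed.

Theorem theorem5 (R : realType) :
  exists (prog : cmd) (C : R) (c : R) (D : nat),
    0 < c /\
    forall (S : eqType) (delta : R) (n k : nat) (x y : n.-tuple S),
      0 < delta -> (0 < n)%N ->
      (forall a : S, (count_mem a y <= k)%N) ->
      exists space fuel : nat,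
        let runs := exec (Input delta n k y) fuel prog (init x) in
        space%:R <= C * Num.max 1 (delta^-1 * k%:R * ln n%:R ^+ 2) /\
        always (halts_within space ((n + 2) ^ D)) runs /\
        1 - n%:R `^ (- c) <= prob R (outcome_in (additive_approx delta x y)) runs.
Proof.
exists program, (16 + 1152 * (ln 2)^-2), 1, 6%N; split=> //.
move=> S delta n k x y delta_gt0 n_gt0 y_mult.
have powE : n%:R `^ (- 1) = n%:R^-1 :> R by rewrite powRN powRr1.
rewrite powE; set X := delta^-1 * _ * _.
have sq0 : 0 <= 1152 * (ln 2)^-2 :> R by rewrite mulr_ge0 // invr_ge0 sqr_ge0.
pose w := Input delta n k y.
have [easy|] := boolP (~~ holds w (init x)
    (And (Le (Lit 2) ParN) (Not (LeDelta (Lit 1) (Lit 1))))).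
  exists 1%N, 2%N => runs.
  have -> : runs = Ret (Some (write (init x) 0 (inl n))).
    by rewrite /runs exec_if (negbTE easy).
  split; [|split].
  - rewrite -[leLHS]mulr1; apply: ler_pM => //; last by rewrite le_max lexx.
    by move: (1152 * _) sq0 => z z0; lra.
  - split=> //=; rewrite max0n.
    by apply: leq_trans (leq_addr 2 n) _; rewrite -{1}[(n + 2)%N]expn1 leq_exp2l; lia.
  - rewrite /output /=; move: easy; rewrite /= negb_and -ltnNge negbK !mulr1 => /orP[n1|d1].
      apply: (@le_trans _ _ 0); last exact: ler0n.
      have -> : n%:R = 1%:R :> R by congr (_%:R); lia.
      by rewrite invr1 subrr.
    have -> : additive_approx delta x y n.
      rewrite /additive_approx /E ler_nat leq_subr /=.
      by rewrite -[leLHS]add0r lerD // ler_peMl.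
    by rewrite lerBlDr lerDl invr_ge0.
rewrite negbK => hard; have := hard.
rewrite /= mulr1 -ltNge => /andP[n_gt1 d1].
have ex_m : exists i, (1 <= delta * i%:R) || (n < i)%N by exists n.+1; rewrite ltnSn orbT.
case: (ex_minnP ex_m) => m m_fine m_min.
have m_gt0 : (0 < m)%N.
  by case: (m) m_fine => //; rewrite mulr0 ler10.
have m_le : (m <= n.+1)%N by apply: m_min; rewrite ltnSn orbT.
have dm : delta * m.-1%:R < 1.
  rewrite ltNge; apply/negP => ge1; have := m_min m.-1.
  by rewrite ge1 => /(_ isT); lia.
(* A symbol of the nonempty [y] occurs at least once; this lets [k + 3] be bounded by a multiple of
   [k]. *)
have k_gt0 : (0 < k)%N.
  apply: leq_trans (y_mult (tnth y (Ordinal n_gt0))).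
  by rewrite -has_count has_pred1 mem_tnth.
have lev_le := up_log2_lt n_gt1.
set lev := (up_log 2 n).+1.
pose sp := adr k (8 * m * lev * lev) (k + 3).
have le_pow : ((n + 2) ^ 2 <= (n + 2) ^ 6)%N by rewrite leq_exp2l; lia.
have sq_n : (n.*2 <= (n + 2) ^ 2)%N by rewrite expnS expn1; nia.
have [fuel [run_always run_prob]] := @run_spec R S (tnth x (Ordinal n_gt0)) delta n k
  x y m lev sp ((n + 2) ^ 6) delta_gt0 n_gt1 erefl m_fine m_min m_gt0 y_mult
  (leqnn _) (slot_count_le n_gt1 m_le lev_le) ltac:(lia) ltac:(lia) ltac:(lia).
exists sp, fuel.+1; rewrite exec_if hard.
by split; first exact: space_bound.
Qed.
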